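(* Let $k$ be a field of characteristic $0$ and let $K/k$ be a function field. Let $S\subset\Omega_{K/k}$ be a finite set of places and let $\Gamma\subset K^*$ be a subgroup contained in $O_S^*$. Then for every $v\in\Omega_{K/k}$, the $v$-adic subtopology of $\Gamma$ is discrete. In particular, for every natural number $M$, every $\mathbf{b}=(b_1,\ldots,b_M)\in (K^* )^M$ and every cofinite subset $\Omega\subset\Omega_{K/k}$, writing $\overline{\Gamma}$ for the closure of $\Gamma$ in $\prod_{v\in\Omega}K_v^*$, we have $$W_{\mathbf b}(\overline{\Gamma})=W_{\mathbf b}(\Gamma)\quad\text{and}\quad W'_{\mathbf b}(\overline{\Gamma})=W'_{\mathbf b}(\Gamma).$$
   Context: A function field $K/k$ means: $K$ is finitely generated over $k$ of transcendence degree $1$ and $k$ is relatively algebraically closed in $K$. $\Omega_{K/k}$ is the set of places of $K/k$ (discrete valuations of $K$ trivial on $k$); for $v\in\Omega_{K/k}$, $K_v$ is the completion of $K$ at $v$. For a finite $S\subset\Omega_{K/k}$, $O_S=\{x\in K: v(x)\ge 0 \text{ for all } v\notin S\}$ and $O_S^*$ is its unit group. For a subgroup $\Gamma\subset K^*$ and $v\in\Omega_{K/k}$, the $v$-adic subtopology of $\Gamma$ is the subspace topology induced by the inclusion $\Gamma\subset K_v^*$. For a cofinite $\Omega\subset\Omega_{K/k}$, $\prod_{v\in\Omega}K_v^*$ carries the product topology and $K^*$ (hence $\Gamma$) is identified with its image under the diagonal embedding; $\overline{\Gamma}$ is the topological closure there. For $\mathbf b\in(K^* )^M$ and a subset $\Theta$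 of a ring containing $K$ (here $\prod_{v\in\Omega}K_v$, with $K$ embedded diagonally), $W_{\mathbf b}(\Theta)$ (resp. $W'_{\mathbf b}(\Theta)$) is the set of $(x_1,\ldots,x_M)\in\Theta^M$ with $\sum_{i=1}^M b_ix_i=0$ (resp. $=1$). *)

(* Defs.v *)
From HB Require Import structures.
From mathcomp Require Import all_boot all_order all_algebra.
From mathcomp Require Import ring_quotient mxpoly.
From mathcomp Require Import all_classical constructive_ereal.
From mathcomp Require Import topology ring.

Set Implicit Arguments.
Unset Strict Implicit.
Unset Printing Implicit Defensive.

Import Order.TTheory GRing.Theory Num.Theory.

Local Open Scope classical_set_scope.
Local Open Scope ring_scope.

Section FunctionField.
Variables (k K : fieldType) (iota : {rmorphism k -> K}).

Definition adjoin (A : set K) : set K :=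
  smallest (fun L : set K => divring_closed (mem L)) (range iota `|` A).

Definition algebraic_over (L : set K) (x : K) : Prop :=
  exists p : {poly K}, [/\ p \is a polyOver (mem L), p != 0 & root p x].

Definition finitely_generated : Prop :=
  exists2 A : set K, finite_set A & adjoin A = [set: K].

(* {t} is a transcendence basis of K over k. *)
Definition transcendence_degree_one : Prop :=
  exists t : K, ~ algebraicOver iota t /\
    forall x, algebraic_over (adjoin [set t]) x.

Definition relatively_algebraically_closed : Prop :=
  forall x, algebraicOver iota x -> range iota x.

Definition function_field : Prop :=
  [/\ finitely_generated, transcendence_degree_one &
      relatively_algebraically_closed].

End FunctionField.

(* A place is represented by its normalised valuation (value group exactly
   int).  Since the value at 0 is fixed to +oo, a place is determined by its
   valuation (lemma place_ext), so that finite and cofinite sets of places have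
   their usual meaning. *)
Record place (k K : fieldType) (iota : {rmorphism k -> K}) := Place {
  place_val :> K -> \bar int;
  place_valNy : forall x, place_val x != -oo%E;
  place_val_eqy : forall x, (place_val x == +oo%E) = (x == 0);
  place_valM : forall x y, place_val (x * y) = (place_val x + place_val y)%E;
  place_valD : forall x y,
    (Order.min (place_val x) (place_val y) <= place_val (x + y)%R)%E;
  place_val_surj : exists x, place_val x = 1%:E;
  place_val_base : forall a : k, a != 0 -> place_val (iota a) = 0%:E }.

Section PlaceTheory.
Variables (k K : fieldType) (iota : {rmorphism k -> K}).
Implicit Types (v w : place iota) (x y : K) (n : int).

Lemma place_ext v w : v =1 w -> v = w.
Proof.
case: v w => [v v1 v2 v3 v4 v5 v6] [w w1 w2 w3 w4 w5 w6] /= /funext vw.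
case: w / vw w1 w2 w3 w4 w5 w6 => *.
by congr Place; exact: Prop_irrelevance.
Qed.

Lemma place_val0 v : v 0 = +oo%E.
Proof. by apply/eqP; rewrite place_val_eqy. Qed.

Lemma place_valP v x : x != 0 -> {n | v x = n%:E}.
Proof.
move=> x0; have := place_valNy v x; have := place_val_eqy v x.
by rewrite (negbTE x0); case: (v x) => [n| |] //; exists n.
Qed.

Lemma place_val1 v : v 1 = 0%:E.
Proof. by rewrite -(rmorph1 iota) place_val_base ?oner_neq0. Qed.

Lemma place_valN v x : v (- x) = v x.
Proof.
rewrite -mulN1r -(rmorph1 iota) -rmorphN place_valM place_val_base ?add0e//.
by rewrite oppr_eq0 oner_neq0.
Qed.

Lemma place_valV v x n : v x = n%:E -> v x^-1 = (- n)%:E.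
Proof.
move=> vx; have x0 : x != 0 by rewrite -(place_val_eqy v) vx.
have [m vm] := place_valP v (invr_neq0 x0); rewrite vm; congr EFin.
have := place_val1 v; rewrite -(divff x0) place_valM vx vm => -[/eqP].
by rewrite addrC addr_eq0 => /eqP.
Qed.

Lemma place_ge_add v n x y : (n%:E <= v x)%E -> (n%:E <= v y)%E ->
  (n%:E <= v (x + y)%R)%E.
Proof. by move=> nx ny; apply: le_trans (place_valD v x y); rewrite le_min nx. Qed.

Lemma place_ge_sub v n x y : (n%:E <= v x)%E -> (n%:E <= v y)%E ->
  (n%:E <= v (x - y)%R)%E.
Proof. by move=> nx ny; apply: place_ge_add; rewrite ?place_valN. Qed.

Lemma place_ge_mul v n m x y : (n%:E <= v x)%E -> (m%:E <= v y)%E ->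
  ((n + m)%:E <= v (x * y)%R)%E.
Proof. by move=> nx ny; rewrite place_valM EFinD leeD. Qed.

End PlaceTheory.

Section Completion.
Variables (k K : fieldType) (iota : {rmorphism k -> K}) (v : place iota).
Implicit Types (u w : nat -> K) (n m : int).

Definition cauchy_seq u : Prop := forall n, exists N, forall i j,
  (N <= i)%N -> (N <= j)%N -> (n%:E <= v (u i - u j)%R)%E.

Definition eventually_ge n u : Prop :=
  exists N, forall i, (N <= i)%N -> (n%:E <= v (u i))%E.

Definition is_cauchy_seq : {pred nat -> K} := fun u => `[< cauchy_seq u >].

Lemma eventually_geD n u w :
  eventually_ge n u -> eventually_ge n w -> eventually_ge n (u + w).
Proof.
move=> [N uN] [M wM]; exists (maxn N M) => i; rewrite geq_max => /andP[Ni Mi].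
by apply: place_ge_add; [exact: uN|exact: wM].
Qed.

Lemma eventually_geN n u : eventually_ge n u -> eventually_ge n (- u).
Proof. by move=> [N uN]; exists N => i Ni; rewrite place_valN uN. Qed.

Lemma eventually_ge_mono n m u : n <= m -> eventually_ge m u -> eventually_ge n u.
Proof.
move=> nm [N uN]; exists N => i Ni; apply: le_trans (uN i Ni).
by rewrite lee_fin.
Qed.

Lemma cauchy_seq_bounded u : cauchy_seq u -> exists n, eventually_ge n u.
Proof.
move=> /(_ 0)[N uN]; have [uN0|uN0] := eqVneq (u N) 0.
  by exists 0, N => i Ni; have := uN i N Ni (leqnn N); rewrite uN0 subr0.
have [n vn] := place_valP v uN0.
exists (Num.min 0 n), N => i Ni; rewrite -(subrK (u N) (u i)).
apply: place_ge_add; last by rewrite vn lee_fin ge_min lexx orbT.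
by apply: le_trans (uN i N Ni (leqnn N)); rewrite lee_fin ge_min lexx.
Qed.

Lemma eventually_geM n m u w :
  eventually_ge n u -> eventually_ge m w -> eventually_ge (n + m) (u * w).
Proof.
move=> [N uN] [M wM]; exists (maxn N M) => i; rewrite geq_max => /andP[Ni Mi].
by apply: place_ge_mul; [exact: uN|exact: wM].
Qed.

Lemma cauchy_seq_cst (x : K) : cauchy_seq (cst x).
Proof. by move=> n; exists 0%N => i j _ _; rewrite subrr place_val0 leey. Qed.

Lemma cauchy_seqM u w : cauchy_seq u -> cauchy_seq w -> cauchy_seq (u * w).
Proof.
move=> cu cw n.
have [a [A uA]] := cauchy_seq_bounded cu; have [b [B wB]] := cauchy_seq_bounded cw.
have [C uC] := cu (n - b); have [D wD] := cw (n - a).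
exists (maxn (maxn A B) (maxn C D)) => i j; rewrite !geq_max.
move=> /andP[/andP[Ai Bi] /andP[Ci Di]] /andP[/andP[Aj Bj] /andP[Cj Dj]].
have -> : (u * w) i - (u * w) j = u i * (w i - w j) + (u i - u j) * w j.
  by rewrite mulrBr mulrBl addrA subrK.
apply: place_ge_add.
  by rewrite -(subrKC a n) place_ge_mul ?uA ?wD.
by rewrite -(subrK b n) place_ge_mul ?uC ?wB.
Qed.

Lemma is_cauchy_seq_subring : subring_closed is_cauchy_seq.
Proof.
split=> [|u w /asboolP cu /asboolP cw|u w /asboolP cu /asboolP cw]; apply/asboolP.
- exact: (@cauchy_seq_cst 1).
- move=> n; have [N uN] := cu n; have [M wM] := cw n.
  exists (maxn N M) => i j; rewrite !geq_max => /andP[Ni Mi] /andP[Nj Mj].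
  have -> : (u - w) i - (u - w) j = (u i - u j) - (w i - w j).
    by rewrite -[(u - w) i]/(u i - w i) -[(u - w) j]/(u j - w j); ring.
  by apply: place_ge_sub; [exact: uN|exact: wM].
- exact: cauchy_seqM.
Qed.

HB.instance Definition _ :=
  GRing.isSubringClosed.Build (nat -> K) is_cauchy_seq is_cauchy_seq_subring.

Record cauchy_ring : Type :=
  CauchySeq { cauchy_val :> nat -> K; _ : cauchy_val \in is_cauchy_seq }.

HB.instance Definition _ := [isSub for cauchy_val].
HB.instance Definition _ := [Choice of cauchy_ring by <:].
HB.instance Definition _ := [SubChoice_isSubComNzRing of cauchy_ring by <:].

Lemma cauchy_ringP (u : cauchy_ring) : cauchy_seq u.
Proof. exact/asboolP/(valP u). Qed.

Definition is_null_seq : {pred cauchy_ring} :=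
  fun u : cauchy_ring => `[< forall n, eventually_ge n u >].

Lemma is_null_seq_idealr : idealr_closed is_null_seq.
Proof.
split=> [||a u w /asboolP nu /asboolP nw].
- by apply/asboolP => n; exists 0%N => i _; rewrite place_val0 leey.
- apply/negP => /asboolP/(_ 1)[N /(_ N (leqnn N))].
  by rewrite place_val1 lee_fin.
- apply/asboolP => n; have [b ab] := cauchy_seq_bounded (cauchy_ringP a).
  apply: eventually_geD (nw n).
  by rewrite -(subrKC b n); exact: eventually_geM ab (nu _).
Qed.

HB.instance Definition _ :=
  isIdealr.Build cauchy_ring is_null_seq is_null_seq_idealr.

Definition completion : Type := {ideal_quot is_null_seq}.

HB.instance Definition _ := GRing.ComNzRing.on completion.
HB.instance Definition _ := Quotient.on completion.
HB.instance Definition _ := isPointed.Build completion 0.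

Implicit Types x y z : completion.

Definition completion_pi (u : cauchy_ring) : completion := \pi_completion%qT u.

Lemma completion_pi_zmod_morphism : zmod_morphism completion_pi.
Proof. exact: (raddfB (\pi_({ideal_quot is_null_seq}))%qT). Qed.

Lemma completion_pi_monoid_morphism : monoid_morphism completion_pi.
Proof.
split; first by rewrite /completion_pi [RHS]piE.
by move=> u w; rewrite /completion_pi [RHS]piE.
Qed.

HB.instance Definition _ := GRing.isZmodMorphism.Build cauchy_ring completion
  completion_pi completion_pi_zmod_morphism.
HB.instance Definition _ := GRing.isMonoidMorphism.Build cauchy_ring completion
  completion_pi completion_pi_monoid_morphism.

Lemma completion_pi_surj x : {u | x = completion_pi u}.
Proof. by exists (repr x); rewrite /completion_pi reprK. Qed.

Lemma completion_pi_eq0 (u : cauchy_ring) :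
  completion_pi u = 0 <-> forall n, eventually_ge n u.
Proof.
rewrite -(rmorph0 completion_pi) /completion_pi.
have := Quotient.idealrBE is_null_seq u 0; rewrite subr0 => E.
by split=> [/eqP|nu]; [rewrite -E => /asboolP|apply/eqP; rewrite -E; apply/asboolP].
Qed.

Lemma mk_cauchy_ring u : cauchy_seq u -> {w : cauchy_ring | w = u :> (nat -> K)}.
Proof. by move=> cu; exists (CauchySeq (asboolT cu : u \in is_cauchy_seq)). Qed.

Lemma completion_mulVf x : x != 0 -> exists y, y * x = 1.
Proof.
have [u ->] := completion_pi_surj x => u0.
have /existsNP[n un] : ~ forall n, eventually_ge n u.
  by move=> /completion_pi_eq0/eqP; exact/negP.
have [N uN] := cauchy_ringP u n.
have uf i : (N <= i)%N -> (v (u i) < n%:E)%E.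
  move=> Ni; rewrite ltNge; apply/negP => nui; apply: un; exists N => j Nj.
  by rewrite -(subrK (u i) (u j)) place_ge_add// uN.
have ui0 i : (N <= i)%N -> u i != 0.
  by move=> /uf; apply: contraTneq => ->; rewrite place_val0 -leNgt leey.
have uV i : (N <= i)%N -> ((- n)%:E <= v (u i)^-1%R)%E.
  move=> Ni; have [m um] := place_valP v (ui0 i Ni).
  by rewrite (place_valV um) lee_fin lerN2 ltW// -lte_fin -um uf.
have [|w wE] := @mk_cauchy_ring (fun i => (u i)^-1).
  move=> m; have [M uM] := cauchy_ringP u (m + n + n).
  exists (maxn N M) => i j; rewrite !geq_max => /andP[Ni Mi] /andP[Nj Mj].
  have -> : (u i)^-1 - (u j)^-1 = (u j - u i) * (u i)^-1 * (u j)^-1.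
    by field; rewrite !ui0.
  by rewrite -(addrK n m) -(addrK n (m + n)) !place_ge_mul ?uV ?uM.
exists (completion_pi w); rewrite -rmorphM -(rmorph1 completion_pi).
apply/eqP; rewrite -subr_eq0 -rmorphB; apply/eqP/completion_pi_eq0 => m.
exists N => i Ni; have -> : (w * u - 1 : cauchy_ring) i = (u i)^-1 * u i - 1.
  by rewrite -[in RHS](congr1 (@^~ i) wE).
by rewrite mulVf ?ui0// subrr place_val0 leey.
Qed.

Definition completion_inv (x : completion) : completion :=
  if x == 0 then 0 else xget 0 [set y | y * x = 1].

Lemma completion_invP x : x != 0 -> completion_inv x * x = 1.
Proof.
move=> x0; rewrite /completion_inv (negbTE x0).
by have [y yx] := completion_mulVf x0; case: xgetP => [//|/(_ y)].
Qed.

Lemma completion_inv0 : completion_inv 0 = 0.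
Proof. by rewrite /completion_inv eqxx. Qed.

HB.instance Definition _ :=
  GRing.ComNzRing_isField.Build completion completion_invP completion_inv0.

Definition completion_embed (x : K) : completion :=
  completion_pi (CauchySeq (asboolT (cauchy_seq_cst x) : cst x \in is_cauchy_seq)).

Lemma completion_embed_zmod_morphism : zmod_morphism completion_embed.
Proof.
by move=> x y; rewrite -rmorphB; congr completion_pi; apply/val_inj.
Qed.

Lemma completion_embed_monoid_morphism : monoid_morphism completion_embed.
Proof.
split; first by rewrite -(rmorph1 completion_pi); congr completion_pi; apply/val_inj.
by move=> x y; rewrite -rmorphM; congr completion_pi; apply/val_inj.
Qed.

HB.instance Definition _ := GRing.isZmodMorphism.Build K completion
  completion_embed completion_embed_zmod_morphism.
HB.instance Definition _ := GRing.isMonoidMorphism.Build K completion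
  completion_embed completion_embed_monoid_morphism.

(* "v x >= n" for the extension of v to the completion *)
Definition completion_ge n (x : completion) : Prop :=
  exists2 u : cauchy_ring, x = completion_pi u & eventually_ge n u.

Lemma completion_ge_pi n (u : cauchy_ring) :
  completion_ge n (completion_pi u) <-> eventually_ge n u.
Proof.
split=> [[w uw nw]|nu]; last by exists u.
have /completion_pi_eq0/(_ n) nuw : completion_pi (u - w) = 0.
  by rewrite rmorphB /= uw subrr.
have uE : cauchy_val (u - w) + cauchy_val w = cauchy_val u by exact: subrK.
by rewrite -uE; exact: eventually_geD.
Qed.

Lemma completion_ge_embed n (x : K) :
  completion_ge n (completion_embed x) <-> (n%:E <= v x)%E.
Proof.
rewrite completion_ge_pi; split=> [[N /(_ N (leqnn N))]//|nx].
by exists 0%N.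
Qed.

Lemma completion_ge0 n : completion_ge n 0.
Proof. by rewrite -(rmorph0 completion_embed) completion_ge_embed place_val0 leey. Qed.

Lemma completion_ge_eq0 x : (forall n, completion_ge n x) -> x = 0.
Proof.
have [u ->] := completion_pi_surj x => nu; apply/completion_pi_eq0 => n.
exact/completion_ge_pi.
Qed.

Lemma completion_geD n x y :
  completion_ge n x -> completion_ge n y -> completion_ge n (x + y).
Proof.
by move=> [u -> nu] [w -> nw]; rewrite -rmorphD completion_ge_pi; exact: eventually_geD.
Qed.

Lemma completion_geN n x : completion_ge n x -> completion_ge n (- x).
Proof. by move=> [u -> nu]; rewrite -rmorphN completion_ge_pi; exact: eventually_geN. Qed.

Lemma completion_geM n m x y :
  completion_ge n x -> completion_ge m y -> completion_ge (n + m) (x * y).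
Proof.
by move=> [u -> nu] [w -> nw]; rewrite -rmorphM completion_ge_pi; exact: eventually_geM.
Qed.

Lemma completion_ge_mono n m x : n <= m -> completion_ge m x -> completion_ge n x.
Proof. by move=> nm [u -> mu]; exists u => //; exact: eventually_ge_mono mu. Qed.

Lemma completion_ge_dist n x y : completion_ge n (x - y) -> completion_ge n (y - x).
Proof. by move=> /completion_geN; rewrite opprB. Qed.

Lemma completion_ge_split n x y z :
  completion_ge n (x - y) -> completion_ge n (y - z) -> completion_ge n (x - z).
Proof. by move=> xy yz; rewrite -(subrK y x) -addrA; exact: completion_geD. Qed.

Definition completion_ent : set_system (completion * completion) :=
  filter_from [set: int] (fun n => [set xy | completion_ge n (xy.1 - xy.2)]).

Lemma completion_ent_filter : Filter completion_ent.
Proof.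
apply: filter_from_filter; first by exists 0.
move=> n m _ _; exists (Num.max n m) => // -[x y] /= xy.
by split; apply: completion_ge_mono xy; rewrite le_max lexx ?orbT.
Qed.

Lemma completion_ent_diagonal A : completion_ent A -> diagonal `<=` A.
Proof.
move=> [n _ nA] [x y] /diagonalP ->; apply: nA => /=.
by rewrite subrr; exact: completion_ge0.
Qed.

Lemma completion_ent_inv A : completion_ent A -> completion_ent A^-1%relation.
Proof.
move=> [n _ nA]; exists n => // -[x y] /= xy; apply: nA => /=.
exact: completion_ge_dist.
Qed.

Lemma completion_ent_split A : completion_ent A ->
  exists2 B, completion_ent B & (B \; B `<=` A)%relation.
Proof.
move=> [n _ nA]; exists [set xy | completion_ge n (xy.1 - xy.2)]; first by exists n.
by move=> [x z] [y /= xy yz]; apply: nA; exact: completion_ge_split xy yz.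
Qed.

HB.instance Definition _ := isUniform.Build completion completion_ent_filter
  completion_ent_diagonal completion_ent_inv completion_ent_split.

Lemma completion_nbhsP (x : completion) (A : set completion) :
  nbhs x A <-> exists n, [set y | completion_ge n (y - x)] `<=` A.
Proof.
rewrite -nbhs_entourageE; split=> [[B [n _ nB] BA]|[n nA]].
  exists n => y /completion_ge_dist xy; apply: BA; apply/xsectionP; exact: nB.
exists [set xy | completion_ge n (xy.1 - xy.2)]; first by exists n.
by move=> y /xsectionP/= /completion_ge_dist; exact: nA.
Qed.

Lemma completion_approx n (x : completion) :
  exists a : K, completion_ge n (x - completion_embed a).
Proof.
have [u ->] := completion_pi_surj x; have [N uN] := cauchy_ringP u n.
exists (u N); rewrite -rmorphB completion_ge_pi; exists N => i Ni.
exact: uN.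
Qed.

Lemma completion_dense : closure (range completion_embed) = [set: completion].
Proof.
apply/seteqP; split=> // x _ A /completion_nbhsP[n nA].
have [a xa] := completion_approx n x.
by exists (completion_embed a); split; [exists a|exact/nA/completion_ge_dist].
Qed.

Lemma completion_hausdorff : hausdorff_space completion.
Proof.
move=> x y xy; apply/eqP; rewrite -subr_eq0; apply/eqP/completion_ge_eq0 => n.
have [||z [/completion_ge_dist xz zy]] :=
    xy [set z | completion_ge n (z - x)] [set z | completion_ge n (z - y)].
- by apply/completion_nbhsP; exists n.
- by apply/completion_nbhsP; exists n.
exact: completion_ge_split xz zy.
Qed.

Lemma completion_cauchy_cvg (F : set_system completion) :
  ProperFilter F -> cauchy F -> cvg F.
Proof.
move=> FF cF.
have Fn (n : nat) : exists a : K, F [set y | completion_ge n%:Z (y - completion_embed a)].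
  have [|[P Q]/= [FP FQ] PQ] := cF [set xy | completion_ge n%:Z (xy.1 - xy.2)].
    by exists n%:Z.
  have [x Px] := filter_ex FP; have [a xa] := completion_approx n%:Z x.
  exists a; apply: filterS FQ => y Qy; apply: completion_ge_split xa.
  exact/completion_ge_dist/(PQ (x, y)).
have [a aP] := choice Fn.
have [u uE] : {w : cauchy_ring | w = a :> (nat -> K)}.
  apply: mk_cauchy_ring => n; exists `|n|%N => i j ni nj; apply/completion_ge_embed.
  have [y [/completion_ge_dist yi yj]] := filter_ex (filterI (aP i) (aP j)).
  rewrite rmorphB; apply: (@completion_ge_mono n (minn i j)%:Z).
    by rewrite (le_trans (ler_norm n))// -abszE lez_nat leq_min ni.
  apply: (@completion_ge_split _ _ y); [apply: completion_ge_mono yi|apply: completion_ge_mono yj].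
    by rewrite lez_nat geq_minl.
  by rewrite lez_nat geq_minr.
apply/cvg_ex; exists (completion_pi u) => A /completion_nbhsP[n nA].
have [N uN] := cauchy_ringP u n.
have := aP (maxn N `|n|%N); apply: filterS => y ya; apply: nA => /=.
apply: completion_ge_split.
  apply: completion_ge_mono ya.
  by rewrite (le_trans (ler_norm n))// -abszE lez_nat leq_maxr.
rewrite /completion_embed -rmorphB completion_ge_pi; exists N => i Ni.
by rewrite [X in v X](_ : _ = a (maxn N `|n|%N) - u i)// -uE; apply: uN => //; rewrite leq_maxl.
Qed.

HB.instance Definition _ :=
  Uniform_isComplete.Build completion completion_cauchy_cvg.

End Completion.

Arguments completion {k K iota} v.
Arguments completion_embed {k K iota} v x.

Definition nonzero (F : fieldType) : set F := [set x | x != 0].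

Arguments nonzero F : clear implicits.

Definition mulgroup (F : fieldType) : Type := set_type (nonzero F).

Section MulGroup.
Variable F : fieldType.

HB.instance Definition _ := SubChoice.on (mulgroup F).

Lemma mulgroup_neq0 (x : mulgroup F) : \val x != 0.
Proof. exact: (set_mem (valP x)). Qed.

Definition mkmulgroup (x : F) (x0 : x != 0) : mulgroup F :=
  exist _ x (mem_set x0).

Definition mulgroup_one : mulgroup F := mkmulgroup (oner_neq0 F).

Definition mulgroup_mul (x y : mulgroup F) : mulgroup F :=
  mkmulgroup (mulf_neq0 (mulgroup_neq0 x) (mulgroup_neq0 y)).

Definition mulgroup_inv (x : mulgroup F) : mulgroup F :=
  mkmulgroup (invr_neq0 (mulgroup_neq0 x)).

Lemma mulgroup_mulA : associative mulgroup_mul.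
Proof. by move=> x y z; apply: val_inj; exact: mulrA. Qed.

Lemma mulgroup_mul1 : left_id mulgroup_one mulgroup_mul.
Proof. by move=> x; apply: val_inj; exact: mul1r. Qed.

Lemma mulgroup_1mul : right_id mulgroup_one mulgroup_mul.
Proof. by move=> x; apply: val_inj; exact: mulr1. Qed.

Lemma mulgroup_mulV : left_inverse mulgroup_one mulgroup_inv mulgroup_mul.
Proof. by move=> x; apply: val_inj; exact: mulVf (mulgroup_neq0 x). Qed.

Lemma mulgroup_Vmul : right_inverse mulgroup_one mulgroup_inv mulgroup_mul.
Proof. by move=> x; apply: val_inj; exact: mulfV (mulgroup_neq0 x). Qed.

HB.instance Definition _ := isGroup.Build (mulgroup F) mulgroup_mulA
  mulgroup_mul1 mulgroup_1mul mulgroup_mulV mulgroup_Vmul.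

End MulGroup.

Section Places.
Variables (k K : fieldType) (iota : {rmorphism k -> K}).
Implicit Types (v : place iota) (S Om : set (place iota)).

(* K_v^* has the subspace topology of K_v; as inversion is continuous on the
   nonzero elements of K_v this is its topology as a topological group. *)
HB.instance Definition _ v := Topological.copy (mulgroup (completion v))
  (set_type (nonzero (completion v) : set (completion v))).

Lemma mulgroup_embed_neq0 v (x : mulgroup K) : completion_embed v (\val x) != 0.
Proof. by rewrite fmorph_eq0 mulgroup_neq0. Qed.

Definition mulgroup_embed v (x : mulgroup K) : mulgroup (completion v) :=
  mkmulgroup (mulgroup_embed_neq0 v x).

(* O_S; S_units S is its unit group O_S^*, as a subset of K^*. *)
Definition S_integers S : set K := [set x | forall v, ~ S v -> (0%:E <= v x)%E].

Definition S_units S : set (mulgroup K) :=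
  [set x | S_integers S (\val x) /\
    exists2 y, S_integers S y & \val x * y = 1].

(* Gamma with the topology induced by the inclusion into K_v^* *)
Definition adic_subtopology (Gamma : set (mulgroup K)) v : topologicalType :=
  initial_topology (fun g : Gamma => mulgroup_embed v (\val g)).

Definition prod_mulgroup Om : Type :=
  prod_topology (fun v : Om => mulgroup (completion (\val v))).

HB.instance Definition _ Om := Topological.on (prod_mulgroup Om).

Definition diag_mulgroup Om (x : mulgroup K) : prod_mulgroup Om :=
  fun v : Om => mulgroup_embed (\val v) x.

Definition prod_completion Om : Type := forall v : Om, completion (\val v).

End Places.

Arguments diag_mulgroup {k K iota} Om x.

Section ProdRing.
Variables (k K : fieldType) (iota : {rmorphism k -> K}).
Variable Om : set (place iota).
Local Notation T := (prod_completion Om).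
Implicit Types f g h : T.

HB.instance Definition _ := gen_eqMixin T.
HB.instance Definition _ := gen_choiceMixin T.

Let zero : T := fun=> 0.
Let one : T := fun=> 1.
Let opp f : T := fun v => - f v.
Let add f g : T := fun v => f v + g v.
Let mul f g : T := fun v => f v * g v.

Let addA : associative add.
Proof. by move=> f g h; apply: functional_extensionality_dep => v; exact: addrA. Qed.
Let addC : commutative add.
Proof. by move=> f g; apply: functional_extensionality_dep => v; exact: addrC. Qed.
Let add0 : left_id zero add.
Proof. by move=> f; apply: functional_extensionality_dep => v; exact: add0r. Qed.
Let addN : left_inverse zero opp add.
Proof. by move=> f; apply: functional_extensionality_dep => v; exact: addNr. Qed.
Let mulA : associative mul.
Proof. by move=> f g h; apply: functional_extensionality_dep => v; exact: mulrA. Qed.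
Let mulC : commutative mul.
Proof. by move=> f g; apply: functional_extensionality_dep => v; exact: mulrC. Qed.
Let mul1 : left_id one mul.
Proof. by move=> f; apply: functional_extensionality_dep => v; exact: mul1r. Qed.
Let mulD : left_distributive mul add.
Proof. by move=> f g h; apply: functional_extensionality_dep => v; exact: mulrDl. Qed.

HB.instance Definition _ := GRing.isZmodule.Build T addA addC add0 addN.
HB.instance Definition _ := GRing.Zmodule_isComPzRing.Build T mulA mulC mul1 mulD.

Definition diag (x : K) : T := fun v => completion_embed (\val v) x.

Lemma diag_zmod_morphism : zmod_morphism diag.
Proof.
by move=> x y; apply: functional_extensionality_dep => v; exact: rmorphB.
Qed.

Lemma diag_monoid_morphism : monoid_morphism diag.
Proof.
split; first by apply: functional_extensionality_dep => v; exact: rmorph1.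
by move=> x y; apply: functional_extensionality_dep => v; exact: rmorphM.
Qed.

HB.instance Definition _ := GRing.isZmodMorphism.Build K T diag diag_zmod_morphism.
HB.instance Definition _ :=
  GRing.isMonoidMorphism.Build K T diag diag_monoid_morphism.

Definition prod_val (x : prod_mulgroup Om) : T := fun v => \val (x v).

Lemma prod_val_diag (x : mulgroup K) :
  prod_val (diag_mulgroup Om x) = diag (\val x).
Proof. by []. Qed.

End ProdRing.

Arguments diag {k K iota} Om x.
Arguments prod_val {k K iota Om} x.

(* The solutions in Theta of the equations "sum of b_i x_i = 0" and "= 1", for a
   subset Theta of a ring R containing K through j *)
Section Linear.
Variables (K : fieldType) (R : pzRingType) (j : {rmorphism K -> R}) (M : nat).
Variables (b : 'I_M -> mulgroup K) (Theta : set R).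

Definition W : set ('I_M -> R) :=
  [set x | (forall i, Theta (x i)) /\ \sum_(i < M) j (\val (b i)) * x i = 0].

Definition W' : set ('I_M -> R) :=
  [set x | (forall i, Theta (x i)) /\ \sum_(i < M) j (\val (b i)) * x i = 1].

End Linear.

(* Main.v *)
Require Import Defs.
From HB Require Import structures.
From mathcomp Require Import all_boot all_order all_algebra.
From mathcomp Require Import polyXY separable.
From mathcomp Require Import all_classical constructive_ereal.
From mathcomp Require Import topology ring.

(** An element [g] of [Gamma] with [v (g - 1) >= 1] is determined by its vector of
    valuations at the places in [S]: if all of them vanish, then [g] has no pole,
    hence lies in [k], and [v (g - 1) >= 1] forces [g = 1].  In characteristic 0 the
    filtration [v (g - 1) >= n] of this group is stable under extraction of roots:
    [v (g^m - 1) = v (g - 1)] for [m <> 0].  Elements with distinct values of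
    [v (g - 1)] are therefore multiplicatively independent, so that at most [#|S|]
    such values occur and [1] is isolated in [Gamma].  A discrete subgroup is closed,
    and the statement on linear equations follows.

    The existence of a pole of [x], for [x] not in [k], goes as follows.  A maximal
    subring [V] of [K] containing [k] and [y = 1/x] but not [x] is a valuation ring.
    As [K] is finite over [k(y)], of degree [N] say, each [f] satisfies an equation
    of degree at most [N] over [k(y)]; two of its terms have the same value, so that
    [f^i y^m] is a unit of [V] for some [0 < i <= N].  Hence [f |-> -m N!/i] is an
    integer valued valuation with ring [V]. *)

Set Implicit Arguments.
Unset Strict Implicit.
Unset Printing Implicit Defensive.

Import Order.TTheory GRing.Theory Num.Theory.

Local Open Scope classical_set_scope.
Local Open Scope ring_scope.

(** * Subrings and subfields as types *)

Section SubringType.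
Variables (K : fieldType) (V : set K) (V_closed : subring_closed (mem V)).

(** The closure proof is an argument, so that the closedness instance can be attached to the
    predicate. *)
Definition subring_pred of subring_closed (mem V) : {pred K} := fun x => x \in V.

HB.instance Definition _ :=
  GRing.isSubringClosed.Build K (subring_pred V_closed) V_closed.

Record subring := Subring { subring_val :> K; _ : subring_val \in subring_pred V_closed }.

HB.instance Definition _ := [isSub for subring_val].
HB.instance Definition _ := [Choice of subring by <:].
HB.instance Definition _ := [SubChoice_isSubComNzRing of subring by <:].
End SubringType.

(** Integrality is relative to a ring morphism, so a subset of [K] has to be turned into the range
    of one. *)
Lemma subring_rmorphism (K : fieldType) (V : set K) :
  subring_closed (mem V) ->
  exists (R : comNzRingType) (j : {rmorphism R -> K}), range j = V.
Proof.
move=> Vc; exists (subring Vc), (val : {rmorphism subring Vc -> K}).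
apply/seteqP; split=> [_ [[x xV] _ <-]|x xV]; first exact: set_mem.
by exists (Subring (mem_set xV : x \in subring_pred Vc)).
Qed.

Section SubfieldType.
Variables (K : fieldType) (L : set K) (L_closed : divring_closed (mem L)).

Definition subfield_pred of divring_closed (mem L) : {pred K} := fun x => x \in L.

HB.instance Definition _ :=
  GRing.isDivringClosed.Build K (subfield_pred L_closed) L_closed.

Record subfield := Subfield { subfield_val :> K; _ : subfield_val \in subfield_pred L_closed }.

HB.instance Definition _ := [isSub for subfield_val].
HB.instance Definition _ := [Choice of subfield by <:].
HB.instance Definition _ := [SubChoice_isSubIntegralDomain of subfield by <:].
HB.instance Definition _ := [SubIntegralDomain_isSubField of subfield by <:].
End SubfieldType.

Lemma subfield_rmorphism (K : fieldType) (L : set K) :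
  divring_closed (mem L) ->
  exists (F : fieldType) (j : {rmorphism F -> K}), range j = L.
Proof.
move=> Lc; exists (subfield Lc), (val : {rmorphism subfield Lc -> K}).
apply/seteqP; split=> [_ [[x xL] _ <-]|x xL]; first exact: set_mem.
by exists (Subfield (mem_set xL : x \in subfield_pred Lc)).
Qed.

(** * Finite extensions *)

Lemma poly_decomp0 (F : fieldType) (p : {poly F}) : p != 0 ->
  exists m q, q.[0] != 0 /\ p = 'X^m * q.
Proof.
move=> p0; have [m [q + ->]] := multiplicity_XsubC p 0.
by rewrite p0 /= => q0; exists m, q; split; rewrite // subr0 mulrC.
Qed.

Lemma poly_const_dropE (R : nzRingType) (p : {poly R}) :
  p = (p`_0)%:P + drop_poly 1 p * 'X.
Proof.
rewrite -[LHS](poly_take_drop 1) expr1; congr (_ + _).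
by apply/polyP => -[|i]; rewrite coef_take_poly coefC.
Qed.

Section Algebraic.
Variables (F K : fieldType) (j : {rmorphism F -> K}).

(** The ring [F[z]]. *)
Definition poly_values (z : K) : set K := [set x | exists p, (map_poly j p).[z] = x].

Lemma poly_values_horner z x (p : {poly F}) :
  poly_values z x -> poly_values z (map_poly j p).[x].
Proof.
move=> [q <-]; exists (p \Po q).
by rewrite map_comp_poly horner_comp.
Qed.

(** A relation for a nonzero [x] in [F[z]], freed of powers of [x], reads [r_0 + x s(x) = 0] with
    [r_0 != 0]. So [1/x = -s(x)/r_0] lies in [F[x]], hence in [F[z]]. *)
Lemma poly_values_divring z :
  algebraicOver j z -> divring_closed (mem (poly_values z)).
Proof.
move=> algz.
have valsM x y : poly_values z x -> poly_values z y -> poly_values z (x * y).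
  by move=> [p <-] [q <-]; exists (p * q); rewrite rmorphM hornerM.
have valsV x : poly_values z x -> poly_values z x^-1.
  have [->|x0] := eqVneq x 0; first by rewrite invr0.
  move=> zx.
  have : algebraicOver j x.
    have [p <-] := zx; apply/integral_algebraic/integral_horner.
      by apply/integral_poly => i; rewrite coef_map; exact: integral_id.
    exact/integral_algebraic.
  move=> [q /poly_decomp0[m [r [r0 ->]]]].
  rewrite rmorphM /= map_polyXn rootM rootE hornerXn (negbTE (expf_neq0 _ x0)) /=.
  move=> /rootP rx.
  suff -> : x^-1 = (map_poly j (- (r`_0)^-1 *: drop_poly 1 r)).[x].
    exact: poly_values_horner.
  have jr0 : j r`_0 != 0 by rewrite fmorph_eq0 -horner_coef0.
  apply: (mulIf x0); rewrite mulVf// linearZ /= hornerZ rmorphN fmorphV.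
  move: rx; rewrite {1}(poly_const_dropE r) rmorphD rmorphM /= map_polyX map_polyC.
  rewrite hornerD hornerM hornerX hornerC => /eqP; rewrite addrC addr_eq0 => /eqP rx.
  by rewrite -mulrA rx mulNr mulrN opprK mulVf.
split; first by rewrite inE; exists 1; rewrite rmorph1 hornerC.
  move=> x y; rewrite !inE => -[p <-] [q <-].
  by exists (p - q); rewrite rmorphB hornerD hornerN.
by move=> x y; rewrite !inE => zx /valsV; exact: valsM.
Qed.

(** The primitive element theorem for finitely many elements, by iterating the case of two. *)
Lemma primitive_seq (s : seq K) : [pchar F] =i pred0 ->
  (forall x, x \in s -> algebraicOver j x) ->
  exists2 z, algebraicOver j z & forall x, x \in s -> poly_values z x.
Proof.
move=> F0; elim: s => [|y s IHs] alg; first by exists 0 => //; exact: algebraic0.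
have [|z [p p0 pz] zs] := IHs; first by move=> x xs; apply: alg; rewrite inE xs orbT.
have [|q q0 qy] := alg y; first by rewrite mem_head.
have [n [nz ny]] := pchar0_PET p0 pz q0 qy F0.
exists (y *+ n - z).
  apply: algebraic_sub; last by exists p.
  by rewrite -mulr_natr -(rmorph_nat j); apply: algebraic_mul (algebraic_id j _); exists q.
move=> x; rewrite inE => /predU1P[->|/zs[r <-]]; first by have [r] := ny; exists r.
by apply: poly_values_horner; have [r' ?] := nz; exists r'.
Qed.

Lemma bounded_degree (z : K) : algebraicOver j z -> exists N, forall x, poly_values z x ->
  exists p : {poly F}, [/\ p != 0, (size p <= N.+1)%N & root (map_poly j p) x].
Proof.
move=> /integral_algebraic[P Pmonic Pz]; exists (size P).-1 => x [q qx].
set N := (size P).-1.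
have szP : size P = N.+1 by rewrite polySpred ?monic_neq0.
(* Row [i] represents [x^i] by the remainder of [q^i] modulo [P]. There are more rows than columns,
   and a nonzero vector of the left kernel gives the coefficients of the relation. *)
pose A := \matrix_(i < N.+1) poly_rV (q ^+ i %% P) : 'M[F]_(N.+1, N).
have : kermx A != 0.
  by rewrite -mxrank_eq0 mxrank_ker subn_eq0 -ltnNge ltnS rank_leq_col.
move=> /rowV0Pn[u /sub_kermxP uA u0]; exists (rVpoly u); split.
- by apply: contraNneq u0 => /(congr1 (@poly_rV F N.+1)); rewrite rVpolyK linear0 => ->.
- exact: size_poly.
have mod_z r : (map_poly j (r %% P)).[z] = (map_poly j r).[z].
  by rewrite [in RHS](divp_eq r P) rmorphD rmorphM /= hornerD hornerM (rootP Pz) mulr0 add0r.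
have sz0 : \sum_i u 0 i *: (q ^+ i %% P) = 0.
  have : rVpoly (u *m A) = 0 by rewrite uA linear0.
  rewrite mulmx_sum_row linear_sum /=; apply: etrans.
  apply: eq_bigr => i _; rewrite linearZ /= rowK poly_rV_K// -ltnS.
  by rewrite (leq_trans _ (eq_leq szP))// ltn_modp monic_neq0.
apply/rootP; rewrite -qx (_ : _.[_] = (map_poly j (\sum_i u 0 i *: (q ^+ i %% P))).[z]).
  by rewrite sz0 rmorph0 horner0.
rewrite rmorph_sum horner_sum (horner_coef_wide _ (_ : (_ <= N.+1)%N)); last first.
  by rewrite size_map_poly size_poly.
apply: eq_bigr => i _; rewrite /= map_polyZ hornerZ mod_z rmorphXn /= horner_exp.
by rewrite coef_map coef_rVpoly_ord.
Qed.
End Algebraic.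

(** * Existence of valuation rings *)

Lemma maximal_subring_avoiding (K : fieldType) (B : set K) (x : K) :
    subring_closed (mem B) -> ~ B x ->
  exists V : set K, [/\ subring_closed (mem V), B `<=` V, ~ V x &
    forall W : set K, subring_closed (mem W) -> V `<=` W -> ~ W x -> W `<=` V].
Proof.
move=> Bc Bx.
pose good (V : set K) := [/\ subring_closed (mem V), B `<=` V & ~ V x].
(* Zorn_bigcup also asks for an upper bound of the empty chain. *)
have [F FP totF|V [VP Vmax]] := @Zorn_bigcup K [set V | V = set0 \/ good V].
  have [[V FV V0]|F0] := pselect (exists2 V, F V & V !=set0); last first.
    left; apply/seteqP; split=> // z [V FV Vz]; case: F0; exists V => //.
    by exists z.
  have Fgood W z : F W -> W z -> good W.
    by move=> /FP[->//|].
  have [z Vz] := V0; have [[V1 _ _] BV _] := Fgood V z FV Vz.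
  right; split.
  - have dir u w : (\bigcup_(X in F) X) u -> (\bigcup_(X in F) X) w ->
        exists W, [/\ F W, W u & W w].
      move=> [W FW Wu] [W' FW' Ww]; have [WW|WW] := totF _ _ FW FW'.
        by exists W'; split=> //; exact: WW.
      by exists W; split=> //; exact: WW.
    split; first by rewrite inE; exists V => //; exact: set_mem.
      move=> u w; rewrite !inE => Uu Uw; have [W [FW Wu Ww]] := dir u w Uu Uw.
      have [[_ WB _] _ _] := Fgood W u FW Wu.
      by exists W => //; apply: set_mem; apply: WB; rewrite inE.
    move=> u w; rewrite !inE => Uu Uw; have [W [FW Wu Ww]] := dir u w Uu Uw.
    have [[_ _ WM] _ _] := Fgood W u FW Wu.
    by exists W => //; apply: set_mem; apply: WM; rewrite inE.
  - by move=> u Bu; exists V => //; exact: BV.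
  - by move=> [W FW Wx]; have [_ _] := Fgood W x FW Wx.
have Bgood : good B by split.
have B1 : B 1 by case: Bc => + _ _; rewrite inE.
(* The maximal set is not empty, since [B] is good and contains [1]. *)
case: VP => [V0|[Vc BV Vx]].
  exfalso; apply: (Vmax B); last by right.
  by split; rewrite V0 // => /(_ 1 B1).
exists V; split=> // W Wc VW Wx z Wz; apply: contrapT => Vz.
apply: (Vmax W); first by split=> // /(_ z Wz).
by right; split=> //; exact: subset_trans VW.
Qed.

(** Reversing the coefficients turns a relation in [1/g] into one in [g]. *)
Lemma reciprocal_horner (K : fieldType) (p : {poly K}) n (g : K) :
  (size p <= n.+1)%N -> g != 0 ->
  (\poly_(i < n.+1) p`_(n - i)).[g] = p.[g^-1] * g ^+ n.
Proof.
move=> pn g0; rewrite horner_poly (horner_coef_wide _ pn) mulr_suml.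
rewrite (reindex_inj rev_ord_inj) /=; apply: eq_bigr => i _.
have lin : (i <= n)%N by rewrite -ltnS.
rewrite subSS (subKn lin) -mulrA; congr (_ * _).
by rewrite exprB ?unitfE// exprVn mulrC.
Qed.

(** * Maximal subrings avoiding an element are valuation rings *)

Section MaximalSubring.
Variables (K : fieldType) (V : set K) (x : K).
Hypotheses (Vc : subring_closed (mem V)) (Vy : V x^-1) (Vx : ~ V x).
Hypothesis Vmax :
  forall W : set K, subring_closed (mem W) -> V `<=` W -> ~ W x -> W `<=` V.

Let S := subring_pred Vc.
Let SP z : reflect (V z) (z \in S).
Proof. by apply: (iffP idP) => [/set_mem|/mem_set]. Qed.

Let x_neq0 : x != 0.
Proof. by apply: contra_notN Vx => /eqP ->; apply/SP; exact: rpred0. Qed.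

(** [V[f]] is a subring strictly larger than [V], so maximality puts [x] in it. *)
Let horner_mem f : ~ V f -> exists2 p, p \is a polyOver S & p.[f] = x.
Proof.
move=> Vf; apply: contrapT => nx; apply: Vf.
apply: (Vmax (W := [set z | exists2 p, p \is a polyOver S & p.[f] = z])) => //.
- split; first by rewrite inE; exists 1; [exact: rpred1|rewrite hornerC].
    move=> u w; rewrite !inE => -[p pS <-] [q qS <-].
    by exists (p - q); [exact: rpredB|rewrite hornerD hornerN].
  move=> u w; rewrite !inE => -[p pS <-] [q qS <-].
  by exists (p * q); [exact: rpredM|rewrite hornerM].
- move=> z Vz; exists z%:P; last by rewrite hornerC.
  by rewrite polyOverC; apply/SP.
- by exists 'X; [exact: polyOverX|rewrite hornerX].
Qed.

(** If the inverse of [u = 1 - r/x] were not in [V], then [x] would lie in [V[1/u]], and [x u^n] in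
    [V] for some [n]. But [u^n = 1 - (r/x) s] with [s] in [V], so [x u^n = x - r s], which forces
    [x] into [V]. *)
Let unit_add r : V r -> V (1 - x^-1 * r)^-1.
Proof.
move=> /SP Sr; apply: contrapT => Vu; set u := 1 - _ in Vu.
have u0 : u != 0 by apply: contra_notN Vu => /eqP ->; rewrite invr0; apply/SP/rpred0.
have Sy : x^-1 \in S by exact/SP.
have Su : u \in S by rewrite rpredB ?rpred1 ?rpredM.
have [p pS px] := horner_mem Vu.
have : x * u ^+ (size p) \in S.
  rewrite -px -(@reciprocal_horner _ p (size p)) ?leqnSn//.
  apply: rpred_horner => //; apply/polyOverP => i; rewrite coef_poly.
  by case: ifP => // _; [exact: (polyOverP pS)|exact: rpred0].
rewrite -[X in x * X](subrK 1) mulrDr mulr1 subrX1 {1}/u addrAC subrr sub0r.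
rewrite !mulNr mulrN !mulrA divff// mul1r => /rpredD xS; apply: Vx; apply/SP.
have /xS : r * \sum_(i < size p) u ^+ i \in S.
  by rewrite rpredM// rpred_sum// => i _; exact: rpredX.
by rewrite addrAC addNr add0r.
Qed.

Lemma maximal_subring_valuation f : V f \/ V f^-1.
Proof.
apply: contrapT => /not_orP[Vf Vf'].
have f0 : f != 0 by apply: contra_notN Vf => /eqP ->; apply/SP/rpred0.
have Sy : x^-1 \in S by exact/SP.
have [R [j jV]] := subring_rmorphism Vc.
have int_S z : z \in S -> integralOver j z.
  by move=> /SP; rewrite -jV => -[r _ <-]; exact: integral_id.
have int_poly p : p \is a polyOver S -> {in p : seq K, integralRange j}.
  by move=> pS; apply/integral_poly => i; apply/int_S/(polyOverP pS).
(* Multiplying [x = p(1/f)] by [f^n] writes [(x - p_0) f^n] as a polynomial in [f] of degree below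
   [n] over [V]. Multiplying by [c/x], where [c] inverts [1 - p_0/x], makes the equation monic. *)
have int_f : integralOver j f.
  have [p pS px] := horner_mem Vf'.
  pose n := size p.
  pose q := \poly_(i < n.+1) p`_(n - i).
  pose c := (1 - x^-1 * p`_0)^-1.
  have Sc : c \in S by apply/SP/unit_add/SP/(polyOverP pS).
  have q_f : (\poly_(i < n) p`_(n - i)).[f] = x * f ^+ n - p`_0 * f ^+ n.
    rewrite -px -(@reciprocal_horner _ p n) ?leqnSn// !horner_poly big_ord_recr /=.
    by rewrite subnn addrK.
  have c0 : 1 - x^-1 * p`_0 != 0.
    rewrite subr_eq0; apply: contra_notN Vx => /eqP xp.
    suff -> : x = p`_0 by exact/SP/(polyOverP pS).
    by rewrite -[x in LHS]mulr1 xp mulrA divff// mul1r.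
  apply: (@integral_root_monic _ _ j f ('X^n - (c * x^-1) *: \poly_(i < n) p`_(n - i))).
  - rewrite monicE lead_coefDl ?lead_coefXn// size_polyXn size_polyN.
    by rewrite ltnS (leq_trans (size_scale_leq _ _))// size_poly.
  - rewrite rootE hornerD hornerN hornerZ hornerXn q_f -mulrBl -mulrA.
    rewrite [x^-1 * _]mulrA mulrBr mulVf// mulrA /c mulVf// mul1r subrr//.
  apply: int_poly; rewrite rpredB ?rpredX ?polyOverX// polyOverZ ?rpredM//.
  apply/polyOverP => i; rewrite coef_poly.
  by case: ifP => // _; [exact: (polyOverP pS)|exact: rpred0].
(* Now [x], an element of [V[f]], is integral over [V]. Its monic equation of degree [n], divided by
   [x^(n-1)], writes [x] as a polynomial in [1/x] over [V], so [x] is in [V]. *)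
have [p pS px] := horner_mem Vf.
have [P Pmonic Px] : integralOver j x.
  by rewrite -px; apply: integral_horner => //; exact: int_poly.
pose n := (size (map_poly j P)).-1; apply: Vx.
have jPmonic : map_poly j P \is monic by exact: monic_map.
have sP : size (map_poly j P) = n.+1 by rewrite polySpred ?monic_neq0.
have := @reciprocal_horner _ (map_poly j P) n x^-1 (eq_leq sP).
rewrite invr_neq0// invrK (rootP Px) mul0r => /(_ isT).
set Q := \poly_(i < _) _; have Q0 : Q`_0 = 1.
  by rewrite coef_poly subn0; exact/eqP/jPmonic.
rewrite (poly_const_dropE Q) Q0.
rewrite hornerD hornerM hornerX hornerC => /eqP; rewrite addr_eq0 => /eqP.
move=> /(congr1 ( *%R^~ x)); rewrite mul1r mulNr -mulrA mulVf// mulr1 => ->.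
apply/SP; rewrite rpredN; apply: rpred_horner => //; apply/polyOverP => i.
rewrite coef_drop_poly coef_poly; case: ifP => // _; last exact: rpred0.
by rewrite coef_map; apply/SP; rewrite -jV; exists P`_(n - (i + 1)).
Qed.
End MaximalSubring.

(** * Places *)

Section IntegerValuation.
Variables (k K : fieldType) (iota : {rmorphism k -> K}) (V : set K) (phi : K -> int).
Hypothesis V_closed : subring_closed (mem V).
Hypothesis V_iota : range iota `<=` V.
Hypothesis phiM : forall x y, x != 0 -> y != 0 -> phi (x * y) = phi x + phi y.
Hypothesis phi_ge0 : forall x, x != 0 -> V x <-> 0 <= phi x.

Let phi1 : phi 1 = 0.
Proof.
have := phiM (oner_neq0 K) (oner_neq0 K); rewrite mulr1 => /eqP.
by rewrite -subr_eq subrr eq_sym => /eqP.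
Qed.

Let phiV x : x != 0 -> phi x^-1 = - phi x.
Proof.
move=> x0; apply/eqP; rewrite -addr_eq0 -phiM ?invr_neq0// mulVf//.
exact/eqP.
Qed.

Let phiX x n : x != 0 -> phi (x ^+ n) = n%:Z * phi x.
Proof.
move=> x0; elim: n => [|n IHn]; first by rewrite expr0 phi1 mul0r.
by rewrite exprS phiM ?expf_neq0// IHn intS mulrDl mul1r.
Qed.

Let phiXz x (n : int) : x != 0 -> phi (x ^ n) = n * phi x.
Proof.
move=> x0; case: n => n; first exact: phiX.
by rewrite NegzE -exprnN phiV ?expf_neq0// phiX// mulNr.
Qed.

(** The values of [phi] may form a proper subgroup of the integers, so [phi] is divided by its least
    positive value [d]. The ultrametric inequality comes from [V] being closed under addition. *)
Lemma place_of_integer_valuation (y : K) : y != 0 -> 0 < phi y ->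
  exists w : place iota, (0%:E < w y)%E.
Proof.
move=> y0 py.
have [d [d_gt0 [e e0 pe] d_min]] : exists d : nat, [/\ (0 < d)%N,
    exists2 e, e != 0 & phi e = d%:Z &
    forall x, x != 0 -> 0 < phi x -> d%:Z <= phi x].
  pose P n := `[< (0 < n)%N /\ exists2 e, e != 0 & phi e = n%:Z >].
  have exP : exists n, P n.
    exists `|phi y|%N; apply/asboolP; split; first by rewrite absz_gt0 gt_eqF.
    by exists y => //; rewrite gtz0_abs.
  case: (ex_minnP exP) => d /asboolP[d0 ed] dmin; exists d; split=> // x x0 px.
  have : P `|phi x|%N.
    apply/asboolP; split; first by rewrite absz_gt0 gt_eqF.
    by exists x => //; rewrite gtz0_abs.
  by move=> /dmin; rewrite -lez_nat gtz0_abs.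
have dz : d%:Z != 0 by rewrite eqz_nat -lt0n.
pose psi x := (phi x %/ d)%Z.
have phiE x : x != 0 -> phi x = psi x * d%:Z.
  move=> x0; rewrite {1}(divz_eq (phi x) d) -/(psi x).
  suff -> : (phi x %% d)%Z = 0 by rewrite addr0.
  (* The remainder is itself a value of [phi], smaller than the least positive one, hence zero. *)
  have E : phi (x * e ^ (- psi x)) = (phi x %% d)%Z.
    rewrite phiM ?expfz_neq0// phiXz// pe mulNr {1}(divz_eq (phi x) d) -/(psi x).
    by rewrite addrAC subrr add0r.
  apply/eqP; apply: contraT => r0.
  have := d_min (x * e ^ (- psi x)); rewrite mulf_neq0 ?expfz_neq0// E.
  rewrite lt_neqAle eq_sym r0 modz_ge0// => /(_ isT isT).
  by rewrite leNgt ltz_pmod.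
have psiM x z : x != 0 -> z != 0 -> psi (x * z) = psi x + psi z.
  by move=> x0 z0; apply: (mulIf dz); rewrite -phiE ?mulf_neq0// phiM// mulrDl -!phiE.
have psi_ge0 x : x != 0 -> V x <-> 0 <= psi x.
  by move=> x0; rewrite phi_ge0// (phiE x x0) pmulr_lge0.
pose w x : \bar int := if x == 0 then +oo%E else (psi x)%:E.
have wE x : x != 0 -> w x = (psi x)%:E by rewrite /w => /negbTE ->.
have w0 : w 0 = +oo%E by rewrite /w eqxx.
have wNy x : w x != -oo%E by rewrite /w; case: ifP.
have wy x : (w x == +oo%E) = (x == 0) by rewrite /w; case: ifP.
have wM x z : w (x * z) = (w x + w z)%E.
  have [->|x0] := eqVneq x 0; first by rewrite mul0r w0; case: (w z) (wNy z).
  have [->|z0] := eqVneq z 0; first by rewrite mulr0 w0; case: (w x) (wNy x).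
  by rewrite !wE ?mulf_neq0// psiM.
have wD x z : (Order.min (w x) (w z) <= w (x + z)%R)%E.
  have [->|s0] := eqVneq (x + z) 0; first by rewrite w0 leey.
  have [->|x0] := eqVneq x 0; first by rewrite add0r ge_min lexx orbT.
  have [->|z0] := eqVneq z 0; first by rewrite addr0 ge_min lexx.
  wlog xz : x z s0 x0 z0 / psi x <= psi z.
    move=> wl; have [/wl|/ltW/wl] := leP (psi x) (psi z); first exact.
    by rewrite minC addrC; apply => //; rewrite addrC.
  rewrite ge_min; apply/orP; left; rewrite !wE// lee_fin.
  (* The value of [z / x] is at least [0], so [z / x] and then [1 + z / x] lie in [V]. *)
  have xzE : x + z = x * (1 + z / x) by rewrite mulrDr mulr1 mulrCA divff// mulr1.
  have u0 : 1 + z / x != 0 by apply: contraNneq s0 => E; rewrite xzE E mulr0.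
  rewrite xzE psiM// lerDl; apply/psi_ge0 => //.
  have : V (z / x).
    apply/psi_ge0; first by rewrite mulf_neq0// invr_neq0.
    have := psiM (z / x) x; rewrite divfK// mulf_neq0 ?invr_neq0//.
    by move=> /(_ isT x0) E; rewrite -(lerD2r (psi x)) add0r -E.
  move=> Vzx; apply/set_mem.
  by apply: (rpredD (rpred1 (subring_pred V_closed))); exact/mem_set.
have wS : exists x, w x = 1%:E.
  exists e; rewrite wE//; congr EFin; apply: (mulIf dz).
  by rewrite -phiE// pe mul1r.
have wB (a : k) : a != 0 -> w (iota a) = 0%:E.
  move=> a0; have ia0 : iota a != 0 by rewrite fmorph_eq0.
  rewrite wE//; congr EFin; apply: (mulIf dz); rewrite -phiE// mul0r; apply/eqP.
  rewrite eq_le; apply/andP; split; last by apply/phi_ge0 => //; apply: V_iota; exists a.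
  rewrite -oppr_ge0 -phiV//; apply/phi_ge0; first by rewrite invr_neq0.
  by apply: V_iota; exists a^-1; rewrite ?fmorphV.
exists (Place wNy wy wM wD wS wB) => /=; rewrite wE// lte_fin.
by rewrite -(pmulr_lgt0 _ (_ : 0 < d%:Z)) -?phiE.
Qed.
End IntegerValuation.

(** The hypothesis is the transcendence of [y]. It keeps denominators nonzero, so that the fractions
    form a field containing [k] and [y]. *)
Lemma adjoin_fraction (k K : fieldType) (iota : {rmorphism k -> K}) (y : K) :
    (forall q : {poly k}, q != 0 -> (map_poly iota q).[y] != 0) ->
  forall c, adjoin iota [set y] c -> exists p q : {poly k},
    q != 0 /\ c = (map_poly iota p).[y] / (map_poly iota q).[y].
Proof.
move=> horner_y_neq0.
pose L := [set c : K | exists p q : {poly k}, q != 0 /\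
  c = (map_poly iota p).[y] / (map_poly iota q).[y]].
have Lc : divring_closed (mem L).
  split; first by rewrite inE; exists 1, 1; rewrite oner_neq0 rmorph1 hornerC divr1.
    move=> u w; rewrite !inE => -[p [q [q0 ->]]] [p' [q' [q0' ->]]].
    exists (p * q' - p' * q), (q * q'); split; first by rewrite mulf_neq0.
    rewrite rmorphB !rmorphM /= hornerD hornerN !hornerM.
    by rewrite -mulNr addf_div ?horner_y_neq0// mulNr.
  move=> u w; rewrite !inE => -[p [q [q0 ->]]] [p' [q' [q0' ->]]].
  have [->|p0] := eqVneq p' 0.
    exists 0, 1; rewrite oner_neq0 rmorph1 !rmorph0 !horner0 hornerC.
    by rewrite !mul0r invr0 mulr0.
  exists (p * q'), (q * p'); split; first by rewrite mulf_neq0.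
  by rewrite invf_div !rmorphM /= !hornerM mulf_div.
suff : adjoin iota [set y] `<=` L by [].
apply: smallest_sub => // z [[a _ <-]|->].
  by exists a%:P, 1; rewrite oner_neq0 rmorph1 map_polyC !hornerC divr1.
by exists 'X, 1; rewrite oner_neq0 rmorph1 map_polyX hornerX hornerC divr1.
Qed.

(** The unit group of the ring [V]; [z != 0] is demanded because [0^-1] is [0]. *)
Definition subunits (K : fieldType) (V : set K) : set K :=
  [set z | [/\ z != 0, V z & V z^-1]].

(** * The place attached to a valuation ring *)

Section ValuationRing.
Variables (K : fieldType) (V : set K).
Hypothesis V_closed : subring_closed (mem V).
Hypothesis V_total : forall f, V f \/ V f^-1.

Let VM x z : V x -> V z -> V (x * z).
Proof.
move=> Vx Vz; apply/set_mem.
by apply: (@rpredM _ (subring_pred V_closed)); exact/mem_set.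
Qed.

Lemma subring_mem1 : V 1.
Proof. exact/set_mem/(rpred1 (subring_pred V_closed)). Qed.

Lemma subring_memX x n : V x -> V (x ^+ n).
Proof.
move=> Vx; elim: n => [|n IHn]; first by rewrite expr0; exact: subring_mem1.
by rewrite exprS; exact: VM.
Qed.

Lemma subunits1 : subunits V 1.
Proof. by split; rewrite ?oner_neq0 ?invr1//; exact: subring_mem1. Qed.

Lemma subunitsM x z : subunits V x -> subunits V z -> subunits V (x * z).
Proof.
by move=> [x0 Vx Vx'] [z0 Vz Vz']; split; rewrite ?mulf_neq0 ?invfM//; exact: VM.
Qed.

Lemma subunitsV x : subunits V x -> subunits V x^-1.
Proof. by move=> [x0 Vx Vx']; split; rewrite ?invr_neq0 ?invrK. Qed.

Lemma subunitsX x n : subunits V x -> subunits V (x ^+ n).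
Proof.
move=> Ux; elim: n => [|n IHn]; first by rewrite expr0; exact: subunits1.
by rewrite exprS; exact: subunitsM.
Qed.

(** A valuation ring is integrally closed: if [x] is not in [V], then [1/x] is, and so is
    [x = x^n (1/x)^(n-1)]. The same argument applies to [1/x]. *)
Lemma subunits_root x n : (0 < n)%N -> x != 0 -> subunits V (x ^+ n) -> subunits V x.
Proof.
case: n => // n _ x0 [_ Vn Vn']; split=> //.
  have [//|Vx] := V_total x.
  have -> : x = x ^+ n.+1 * x^-1 ^+ n by rewrite exprS exprVn mulfK ?expf_neq0.
  by apply: VM => //; exact: subring_memX.
have [Vx|//] := V_total x.
have -> : x^-1 = (x ^+ n.+1)^-1 * x ^+ n.
  by rewrite exprS invfM -mulrA mulVf ?expf_neq0// mulr1.
by apply: VM => //; exact: subring_memX.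
Qed.

Variable y : K.
Hypotheses (y0 : y != 0) (Vy : V y) (Vy' : ~ V y^-1).

Let subunits_expz (m : int) : subunits V (y ^ m) -> m = 0.
Proof.
have pos n : ~ subunits V (y ^+ n.+1).
  by move=> /subunits_root [//|//|_ _ /Vy'].
case: m => [[//|n] Un|n /subunitsV]; first by case: (pos n).
by rewrite NegzE -exprnN invrK => Un; case: (pos n).
Qed.

(** As [N!] is a multiple of every exponent [i], one can define [phi f] as the [m] for which
    [f^(N!)] is a unit times [y^m]. It is unique because no nonzero power of [y] is a unit, and
    uniqueness makes [phi] additive, with [phi y = N!]. *)
Lemma place_of_valuation_ring (k : fieldType) (iota : {rmorphism k -> K}) (N : nat) :
    range iota `<=` V ->
    (forall f, f != 0 -> exists i (m : int),
      [/\ (0 < i)%N, (i <= N)%N & subunits V (f ^+ i * y ^ m)]) ->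
  exists w : place iota, (0%:E < w y)%E.
Proof.
move=> V_iota VN.
have M0 : (0 < N`!)%N := fact_gt0 N.
have /choice[phi phiP] : forall f, exists m : int, f != 0 ->
    subunits V (f ^+ N`! * y ^ (- m)).
  move=> f; have [->|f0] := eqVneq f 0; first by exists 0.
  have [i [m [i0 iN Ui]]] := VN f f0; exists (- (m * (N`! %/ i)%:Z)) => _.
  rewrite opprK -exprz_exp -exprnP -{1}(divnK (_ : i %| N`!)%N).
    by rewrite mulnC exprM -exprMn; exact: subunitsX.
  by rewrite dvdn_fact// i0.
have phi_uniq f m : f != 0 -> subunits V (f ^+ N`! * y ^ (- m)) -> phi f = m.
  move=> f0 /subunitsM /(_ (subunitsV (phiP f f0))).
  rewrite invfM mulrACA mulfV ?expf_neq0// mul1r invr_expz opprK -expfzDr//.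
  by move=> /subunits_expz/eqP; rewrite addrC subr_eq0 => /eqP.
have phiM f g : f != 0 -> g != 0 -> phi (f * g) = phi f + phi g.
  move=> f0 g0; apply: phi_uniq; rewrite ?mulf_neq0// exprMn opprD expfzDr// mulrACA.
  by apply: subunitsM; exact: phiP.
have phi_mem f : f != 0 -> V f -> 0 <= phi f.
  (* If [phi f = -(n + 1)], then [f^(N!) y^(n+1)] is a unit; its inverse times [f^(N!) y^n] is
     [1/y], which would lie in [V]. *)
  move=> f0 Vf; have := phiP f f0; case: (phi f) => // n.
  rewrite NegzE opprK exprSz => -[_ _]; rewrite !invfM mulrCA => Vn; exfalso; apply: Vy'.
  have -> : y^-1 = (y^-1 * ((f ^+ N`!)^-1 * (y ^+ n)^-1)) * (f ^+ N`! * y ^+ n).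
    by rewrite -invfM -mulrA mulVf ?mulr1// mulf_neq0 ?expf_neq0.
  apply: VM; last by apply: VM; exact: subring_memX.
  by move: Vn; rewrite mulrCA.
have phiV f : f != 0 -> phi f^-1 = - phi f.
  move=> f0; apply: phi_uniq; first exact: invr_neq0.
  by rewrite exprVn -invr_expz -invfM; exact/subunitsV/phiP.
apply: (place_of_integer_valuation V_closed V_iota phiM _ y0).
  move=> f f0; split; first exact: phi_mem.
  move=> pf; have [//|Vf] := V_total f.
  have /eqP pf0 : phi f == 0.
    by rewrite eq_le pf andbT -oppr_ge0 -phiV// phi_mem// invr_neq0.
  have := phiP f f0; rewrite pf0 oppr0 expr0z mulr1 => /subunits_root[]//.
rewrite (phi_uniq y N`!%:Z)//.
by rewrite -exprnN mulfV ?expf_neq0//; exact: subunits1.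
Qed.

(** The maximal ideal of [V]: by totality, [z] lies in [V] as soon as [1/z] does not. *)
Let nonunit z := z = 0 \/ ~ V z^-1.

(** Say [b/a] is in [V]. If [1/(a + b)] were in [V], so would be [1/a = (1 + b/a) / (a + b)]. *)
Let nonunitD a b : nonunit a -> nonunit b -> nonunit (a + b).
Proof.
have key u w : u != 0 -> ~ V u^-1 -> V (w / u) -> nonunit (u + w).
  move=> u0 Vu Vwu; have [s0|s0] := eqVneq (u + w) 0; [by left|right => Vs; apply: Vu].
  have -> : u^-1 = (1 + w / u) * (u + w)^-1.
    have -> : 1 + w / u = (u + w) / u by rewrite mulrDl divff.
    by rewrite mulrAC divff// mul1r.
  apply: VM => //; apply/set_mem; apply: (@rpredD _ (subring_pred V_closed)).
    exact: rpred1.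
  exact/mem_set.
have [->|a0] := eqVneq a 0; first by rewrite add0r.
have [->|b0] := eqVneq b 0; first by rewrite addr0.
move=> [/eqP|Va]; first by rewrite (negbTE a0).
move=> [/eqP|Vb]; first by rewrite (negbTE b0).
have [ba|] := V_total (b / a); first exact: key.
by rewrite invf_div addrC => ab; exact: key.
Qed.

Let not_nonunit z : z != 0 -> ~ nonunit z -> V z^-1.
Proof. by move=> /eqP z0 /not_orP[_ /contrapT]. Qed.

(** Divide by a term [T j] of least value. The other quotients sum to [-1], so they cannot all lie
    in the maximal ideal. *)
Lemma valuation_vanishing_sum (I : finType) (T : I -> K) (i0 : I) :
  T i0 != 0 -> \sum_i T i = 0 ->
  exists i j, [/\ i != j, T i != 0, T j != 0 & subunits V (T i / T j)].
Proof.
move=> T0 sT.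
have [j [Tj0 Tj]] : exists j, T j != 0 /\ forall i, V (T i / T j).
  suff [j [Tj0 Tj]] : exists j, T j != 0 /\ forall i, i \in enum I -> V (T i / T j).
    by exists j; split=> // i; apply: Tj; rewrite mem_enum.
  elim: (enum I) => [|l s [j [Tj0 Tj]]]; first by exists i0.
  have [Tlj|Tjl] := V_total (T l / T j).
    by exists j; split=> // i; rewrite inE => /predU1P[->//|/Tj].
  have [Tl0|Tl0] := eqVneq (T l) 0.
    exists j; split=> // i; rewrite inE => /predU1P[->|/Tj//].
    by move: Tjl; rewrite Tl0 mul0r invr0.
  exists l; split=> // i; rewrite inE => /predU1P[->|/Tj Tij].
    by rewrite divff//; exact: subring_mem1.
  have -> : T i / T l = T i / T j * (T l / T j)^-1 by rewrite invf_div mulrA divfK.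
  exact: VM.
apply: contrapT => nex.
have : nonunit (\sum_(i | i != j) T i / T j).
  apply: (big_ind nonunit) => [|a b|i ij]; [by left|exact: nonunitD|].
  have [->|Ti0] := eqVneq (T i) 0; first by rewrite mul0r; left.
  right => Vij; apply: nex; exists i, j; split=> //.
  by split=> //; rewrite mulf_neq0// invr_neq0.
have -> : \sum_(i | i != j) T i / T j = -1.
  move: sT; rewrite (bigD1 j)//= addrC => /eqP; rewrite addr_eq0 => /eqP sT.
  by rewrite -mulr_suml sT mulNr divff.
case=> [/eqP|]; first by rewrite oppr_eq0 oner_eq0.
rewrite invrN1; apply; apply/set_mem.
by rewrite -[_ \in _]/(-1 \in subring_pred V_closed) rpredN; exact: rpred1.
Qed.

Section BaseField.
Variables (k : fieldType) (iota : {rmorphism k -> K}).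
Hypothesis V_iota : range iota `<=` V.

Let poly_mem (p : {poly k}) : V (map_poly iota p).[y].
Proof.
apply/set_mem; apply: (@rpred_horner _ (subring_pred V_closed)); last exact/mem_set.
by apply/polyOverP => i; rewrite coef_map; apply/mem_set/V_iota; exists p`_i.
Qed.

(** Write [p = X^m q] with [q(0) != 0]. Modulo the maximal ideal, [q(y)] is the nonzero constant
    [q(0)], hence a unit. *)
Let poly_unit (p : {poly k}) : p != 0 ->
  exists m : int, subunits V ((map_poly iota p).[y] * y ^ m).
Proof.
move=> /poly_decomp0[m [q [q0 ->]]]; exists (- m%:Z).
rewrite rmorphM /= map_polyXn hornerM hornerXn mulrAC -exprnN mulfV ?expf_neq0// mul1r.
set z := _.[y]; have : ~ nonunit z.
  move=> nz; have : nonunit (iota q.[0]).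
    have -> : iota q.[0] = z + - (map_poly iota (drop_poly 1 q)).[y] * y.
      have -> : z = iota q`_0 + (map_poly iota (drop_poly 1 q)).[y] * y.
        rewrite /z [in LHS](poly_const_dropE q) rmorphD rmorphM /= map_polyX map_polyC.
        by rewrite hornerD hornerM hornerX hornerC.
      by rewrite mulNr addrK horner_coef0.
    apply: nonunitD => //; set s := - _.
    have Vs : V s.
      apply/set_mem; rewrite -[_ \in _]/(s \in subring_pred V_closed) rpredN.
      exact/mem_set/poly_mem.
    have [->|s0] := eqVneq s 0; first by rewrite mul0r; left.
    right; rewrite invfM => Vsy; apply: Vy'.
    by have := VM Vs Vsy; rewrite mulrA divff// mul1r.
  case=> [/eqP|]; first by rewrite fmorph_eq0 (negbTE q0).
  by rewrite -fmorphV; apply; apply: V_iota; exists (q.[0])^-1.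
move=> nz; have z0 : z != 0 by apply: contra_notN nz => /eqP; left.
split=> //; [exact: poly_mem|exact: not_nonunit].
Qed.

(* y is transcendental over k, as its inverse is not even in k[y]. *)
Let horner_y_neq0 (q : {poly k}) : q != 0 -> (map_poly iota q).[y] != 0.
Proof.
by move=> /poly_unit[m [+ _ _]]; apply: contra_neq => ->; rewrite mul0r.
Qed.

Lemma adjoin_unit (c : K) : adjoin iota [set y] c -> c != 0 ->
  exists m : int, subunits V (c * y ^ m).
Proof.
move=> /(adjoin_fraction horner_y_neq0)[p [q [q0 ->]]] pq0.
have p0 : p != 0 by apply: contraNneq pq0 => ->; rewrite rmorph0 horner0 mul0r.
have [[a Ua] [b Ub]] := (poly_unit p0, poly_unit q0); exists (a - b).
rewrite expfzDr// -invr_expz mulrACA -invfM.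
by apply: subunitsM => //; exact: subunitsV.
Qed.

Lemma place_of_bounded_degree (F : fieldType) (j : {rmorphism F -> K}) (N : nat) :
    range j = adjoin iota [set y] ->
    (forall f : K, exists p : {poly F},
      [/\ p != 0, (size p <= N.+1)%N & root (map_poly j p) f]) ->
  exists w : place iota, (0%:E < w y)%E.
Proof.
move=> jF deg; apply: (place_of_valuation_ring (N := N) V_iota) => f f0.
have [p [p0 pN /rootP pf]] := deg f.
pose T (i : 'I_N.+1) := j p`_i * f ^+ i.
have sT : \sum_i T i = 0.
  apply: etrans pf; rewrite (@horner_coef_wide _ N.+1) ?size_map_poly//.
  by apply: eq_bigr => i _; rewrite coef_map.
have pl : ((size p).-1 < N.+1)%N by rewrite (leq_trans _ pN)// prednK// size_poly_gt0.
have [|a [b [ab]]] := @valuation_vanishing_sum _ T (Ordinal pl) _ sT.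
  by rewrite /T mulf_neq0 ?expf_neq0// fmorph_eq0 -/(lead_coef p) lead_coef_eq0.
wlog lt_ba : a b ab / (b < a)%N.
  move=> wl Ta0 Tb0 UT; have [ba|ab'|/val_inj/eqP E] := ltngtP b a.
  - exact: (wl a b).
  - by apply: (wl b a) => //; rewrite 1?eq_sym// -invf_div; exact: subunitsV.
  - by rewrite eq_sym (negbTE ab) in E.
move=> Ta0 Tb0 UT.
have cF (i : 'I_N.+1) : T i != 0 -> exists m : int, subunits V (j p`_i * y ^ m).
  rewrite mulf_eq0 negb_or => /andP[pi _]; apply: adjoin_unit => //.
  by rewrite -jF; exists p`_i.
have [[m Um] [l Ul]] := (cF _ Ta0, cF _ Tb0).
have [ja0 jb0] : j p`_a != 0 /\ j p`_b != 0.
  by split; [move: Ta0|move: Tb0]; rewrite mulf_eq0 negb_or => /andP[].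
exists (a - b)%N, (l - m); split; rewrite ?subn_gt0//.
  by rewrite (leq_trans (leq_subr _ _))// -ltnS.
(* [T a / T b] is [f^(a-b)] times a ratio of coefficients, which up to units is a power of [y]. *)
have -> : f ^+ (a - b) * y ^ (l - m) =
    (T a / T b) * ((j p`_b * y ^ l) / (j p`_a * y ^ m)).
  rewrite /T exprB ?unitfE// 1?ltnW// expfzDr// -invr_expz.
  field.
  by rewrite ?ja0 ?jb0 ?expf_neq0 ?expfz_neq0.
apply: subunitsM => //; apply: subunitsM => //; exact: subunitsV.
Qed.
End BaseField.
End ValuationRing.

(** * Poles in function fields *)

Section FunctionFieldPlaces.
Variables (k K : fieldType) (iota : {rmorphism k -> K}).

Lemma adjoin_divring_closed (A : set K) : divring_closed (mem (adjoin iota A)).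
Proof.
split; first by rewrite inE => L [[L1 _ _] _]; apply/set_mem.
  move=> u w; rewrite !inE => Au Aw L [[L1 LB LV] AL].
  by apply/set_mem/LB; apply/mem_set; [exact: Au|exact: Aw].
move=> u w; rewrite !inE => Au Aw L [[L1 LB LV] AL].
by apply/set_mem/LV; apply/mem_set; [exact: Au|exact: Aw].
Qed.

Lemma sub_adjoin (A : set K) : range iota `|` A `<=` adjoin iota A.
Proof. exact: sub_smallest. Qed.

Lemma integral_divring_closed (F : fieldType) (j : {rmorphism F -> K}) :
  divring_closed (mem [set x | integralOver j x]).
Proof.
split; first by rewrite inE; exact: integral1.
  by move=> u w; rewrite !inE; exact: integral_sub.
by move=> u w; rewrite !inE; exact: integral_div.
Qed.

(** The relation is multiplied by the product of the denominators of its coefficients. In [Q] the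
    outer variable stands for [y], the inner one for [t]. *)
Lemma algebraic_clear_denominators (t y : K) :
    (forall q : {poly k}, q != 0 -> (map_poly iota q).[t] != 0) ->
    algebraic_over (adjoin iota [set t]) y ->
  exists Q : {poly {poly k}}, Q != 0 /\
    (map_poly (map_poly iota) Q).[y%:P].[t] = 0.
Proof.
move=> nt [P [PS P0 /rootP Py]].
have PL i : adjoin iota [set t] P`_i.
  pose L := subfield_pred (adjoin_divring_closed [set t]).
  by apply/set_mem; apply: (polyOverP (_ : P \is a polyOver L)).
have /choice[pq pqP] : forall i, exists pq : {poly k} * {poly k}, pq.2 != 0 /\
    P`_i = (map_poly iota pq.1).[t] / (map_poly iota pq.2).[t].
  by move=> i; have [p [q ?]] := adjoin_fraction nt (PL i); exists (p, q).
pose D := \prod_(i < size P) (pq i).2.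
pose Q := \poly_(i < size P) ((pq i).1 * (D %/ (pq i).2)).
have QE i : (map_poly iota Q`_i).[t] = (map_poly iota D).[t] * P`_i.
  rewrite coef_poly; case: ltnP => [iP|Pi]; last first.
    by rewrite rmorph0 horner0 nth_default// mulr0.
  have [q0 ->] := pqP i.
  have {2}-> : D = (D %/ (pq i).2) * (pq i).2.
    by rewrite divpK// /D (bigD1 (Ordinal iP))//= dvdp_mulIl.
  rewrite !rmorphM /= !hornerM mulrC [RHS]mulrC mulrA -[in RHS]mulrA.
  rewrite [(map_poly iota (pq i).1).[t] / _]mulrC.
  by rewrite [RHS]mulrC -!mulrA mulVKf// nt.
have D0 : (map_poly iota D).[t] != 0.
  by apply: nt; apply/prodf_neq0 => i _; have [] := pqP i.
exists Q; split.
  apply: contra_neq P0 => Q0; apply/polyP => i; rewrite coef0.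
  by apply: (mulfI D0); rewrite -QE Q0 coef0 rmorph0 horner0 mulr0.
have QP : (size (map_poly (map_poly iota) Q) <= size P)%N.
  by apply: leq_trans (size_poly _ _) _; exact: size_poly.
rewrite (horner_coef_wide _ QP).
rewrite horner_sum.
rewrite (eq_bigr (fun i : 'I__ => (map_poly iota D).[t] * (P`_i * y ^+ i))).
  by rewrite -mulr_sumr -horner_coef Py mulr0.
by move=> i _; rewrite coef_map -polyC_exp hornerM hornerC QE mulrA.
Qed.

(** Steinitz exchange: with its variables swapped, the relation between [t] and [y] is an equation
    for [t] over [k[y]]. *)
Lemma algebraic_exchange (t y : K) (F : fieldType) (j : {rmorphism F -> K}) :
    ~ algebraicOver iota t -> ~ algebraicOver iota y ->
    range j = adjoin iota [set y] -> algebraic_over (adjoin iota [set t]) y ->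
  integralOver j t.
Proof.
move=> nt ny jF.
have horner_neq0 z : ~ algebraicOver iota z ->
    forall q : {poly k}, q != 0 -> (map_poly iota q).[z] != 0.
  by move=> nz q q0; apply: contra_notN nz => /eqP/rootP qz; exists q.
move=> /(algebraic_clear_denominators (horner_neq0 t nt))[Q [Q0 Qty]].
pose R := map_poly (horner_eval y) (map_poly (map_poly iota) (swapXY Q)).
have RE i : R`_i = (map_poly iota (swapXY Q)`_i).[y] by rewrite !coef_map.
apply: (@integral_root _ _ j R).
(* The equation is nontrivial: a nonzero coefficient in [k[Y]] does not vanish at the transcendental
   [y]. *)
- have : swapXY Q != 0 by rewrite swapXY_eq0.
  apply: contra_neq => R0; apply/polyP => i; rewrite coef0; apply/eqP.
  apply: contraT => /(horner_neq0 y ny); rewrite -RE R0 coef0 eqxx//.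
- apply/rootP; rewrite -Qty -[RHS]horner2_swapXY swapXY_map /R.
  by rewrite -[t in LHS](hornerC t y) -/(horner_eval y t%:P) horner_map.
apply/integral_poly => i; rewrite RE.
have : adjoin iota [set y] (map_poly iota (swapXY Q)`_i).[y].
  have yL : y \in mem (adjoin iota [set y]) by rewrite inE; apply: sub_adjoin; right.
  apply/set_mem; set L := subfield_pred (adjoin_divring_closed [set y]).
  apply: (@rpred_horner _ L) => //; apply/polyOverP => l; rewrite coef_map.
  by apply/mem_set; apply: sub_adjoin; left; exists (swapXY Q)`_i`_l.
by rewrite -jF => -[r _ <-]; exact: integral_id.
Qed.

Lemma exists_pole (x : K) : [pchar k] =i pred0 -> function_field iota ->
  ~ range iota x -> exists w : place iota, (w x < 0%:E)%E.
Proof.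
move=> k0 [[A Afin adjA] [t [nt algt]] closed_k] nx.
have x0 : x != 0.
  by apply: contra_notN nx => /eqP ->; exists 0; rewrite ?rmorph0.
have ny : ~ algebraicOver iota x^-1.
  move=> /closed_k[a _ /(congr1 (@GRing.inv K))]; rewrite invrK -fmorphV => ax.
  by apply: nx; exists a^-1.
set y := x^-1 in ny *.
have y0 : y != 0 by rewrite invr_neq0.
have [F [j jF]] := subfield_rmorphism (adjoin_divring_closed [set y]).
have F0 : [pchar F] =i pred0.
  by move=> p; rewrite -(fmorph_pchar j) (fmorph_pchar iota) k0.
have jk a : integralOver j (iota a).
  have [r _ <-] : range j (iota a); last exact: integral_id.
  by rewrite jF; apply: sub_adjoin; left; exists a.
(* Since [t] is algebraic over [k(y)], so is all of [K], which is algebraic over [k(t)]. *)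
have int_t := algebraic_exchange nt ny jF (algt y).
have int_kt : adjoin iota [set t] `<=` [set z | integralOver j z].
  apply: smallest_sub; first exact: integral_divring_closed.
  by move=> z [[a _ <-]|->]; [exact: jk|exact: int_t].
have int_all z : integralOver j z.
  have [P [PS P0 Pz]] := algt z.
  apply: integral_root P0 Pz _; apply/integral_poly => i; apply: int_kt.
  pose L := subfield_pred (adjoin_divring_closed [set t]).
  by apply/set_mem; apply: (polyOverP (_ : P \is a polyOver L)).
(* Finite generation gives a primitive element: [K = F[z]] with [F = k(y)], so that degrees over [F]
   are bounded. *)
have /finite_seqP[s As] := Afin.
have [|z zalg zs] := @primitive_seq _ _ j s F0.
  by move=> u _; exact/integral_algebraic.
have all_z f : poly_values j z f.
  have : adjoin iota A `<=` poly_values j z.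
    apply: smallest_sub; first exact: poly_values_divring.
    move=> u [[a _ <-]|]; last by rewrite As => /zs.
    have [r _ <-] : range j (iota a).
      by rewrite jF; apply: sub_adjoin; left; exists a.
    by exists r%:P; rewrite map_polyC hornerC.
  by rewrite adjA; apply.
have [N deg] := bounded_degree zalg.
have Bc : subring_closed (mem (poly_values iota y)).
  split; first by rewrite inE; exists 1; rewrite rmorph1 hornerC.
    move=> u w; rewrite !inE => -[p <-] [q <-].
    by exists (p - q); rewrite rmorphB hornerD hornerN.
  move=> u w; rewrite !inE => -[p <-] [q <-].
  by exists (p * q); rewrite rmorphM hornerM.
(* If [x = p(y)], then [y p(y) = 1] is a nontrivial relation for [y], as its constant term is
   [-1]. *)
have Bx : ~ poly_values iota y x.
  move=> [p px]; apply: ny; exists ('X * p - 1).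
    rewrite subr_eq0; apply/negP => /eqP/(congr1 (horner^~ 0)).
    by rewrite hornerM hornerX mul0r hornerC => /eqP; rewrite eq_sym oner_eq0.
  rewrite rmorphB rmorphM /= rmorph1 map_polyX rootE hornerD hornerN hornerM.
  by rewrite hornerX hornerC px mulVf// subrr.
have [V [Vc BV Vx Vmax]] := maximal_subring_avoiding Bc Bx.
have Vy : V y by apply: BV; exists 'X; rewrite map_polyX hornerX.
have Vk : range iota `<=` V.
  by move=> _ [a _ <-]; apply: BV; exists a%:P; rewrite map_polyC hornerC.
have Vtot := maximal_subring_valuation Vc Vy Vx Vmax.
have Vy' : ~ V y^-1 by rewrite invrK.
have [|w wy] := place_of_bounded_degree Vc Vtot y0 Vy Vy' Vk (N := N) jF.
  by move=> f; exact: deg.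
exists w; have [n wx] := place_valP w x0.
by move: wy; rewrite (place_valV wx) wx !lte_fin oppr_gt0.
Qed.
End FunctionFieldPlaces.

(** * One-units *)

Section OneUnits.
Variables (k K : fieldType) (iota : {rmorphism k -> K}) (v : place iota).
Hypothesis char_k : [pchar k] =i pred0.

(** The subgroup criterion, for sets of field elements so that [g - 1] can be formed directly. *)
Definition division_closed (G : set K) : Prop :=
  G 1 /\ forall g h, G g -> G h -> G (g / h).

Lemma division_closedV (G : set K) g : division_closed G -> G g -> G g^-1.
Proof. by move=> [G1 Gd] Gg; rewrite -div1r; exact: Gd. Qed.

Lemma division_closedM (G : set K) g h : division_closed G -> G g -> G h -> G (g * h).
Proof.
by move=> Gc Gg Gh; rewrite -[h]invrK; apply: Gc.2 => //; exact: division_closedV.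
Qed.

Lemma division_closedXz (G : set K) g (m : int) : division_closed G -> G g -> G (g ^ m).
Proof.
move=> Gc Gg; have GX n : G (g ^+ n).
  elim: n => [|n IHn]; first by rewrite expr0; exact: Gc.1.
  by rewrite exprS; exact: division_closedM.
by case: m => n; rewrite ?NegzE -?exprnN; [exact: GX|exact: division_closedV].
Qed.

(** The higher unit group at [v] of level [max(1, n)]. *)
Definition one_units (n : int) : set K :=
  [set g | (1%:E <= v (g - 1)%R)%E /\ (n%:E <= v (g - 1)%R)%E].

Lemma one_units_val g n : one_units n g -> v g = 0%:E.
Proof.
move=> [g1 _]; have g0 : g != 0.
  by apply: contraTneq g1 => ->; rewrite sub0r place_valN place_val1 lee_fin.
have [m vg] := place_valP v g0; rewrite vg; congr EFin; apply/eqP.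
rewrite eq_le; apply/andP; split.
  rewrite leNgt; apply/negP => m0.
  have : (1%:E <= v (g - (g - 1))%R)%E.
    by apply: place_ge_sub => //; rewrite vg lee_fin -gtz0_ge1.
  by rewrite opprB addrC subrK place_val1 lee_fin.
rewrite -lee_fin -vg -(subrK 1 g); apply: place_ge_add.
  by apply: le_trans g1; rewrite lee_fin.
by rewrite place_val1.
Qed.

Lemma one_units_division_closed n : division_closed (one_units n).
Proof.
split; first by rewrite /one_units /= subrr place_val0 !leey.
move=> g h gn hn; have [[g1 gn'] [h1 hn']] := (gn, hn).
have h0 : h != 0 by rewrite -(place_val_eqy v) (one_units_val hn).
have E : g / h - 1 = h^-1 * ((g - 1) - (h - 1)).
  by field.
have vE : v (g / h - 1) = v ((g - 1) - (h - 1)).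
  by rewrite E place_valM (place_valV (one_units_val hn)) oppr0 add0e.
by split; rewrite vE; exact: place_ge_sub.
Qed.

Lemma place_val_nat n : (0 < n)%N -> v n%:R = 0%:E.
Proof.
move=> n0; rewrite -(rmorph_nat iota) place_val_base//.
by move/pcharf0P: char_k => ->; rewrite -lt0n.
Qed.

Lemma place_ge_sum (I : Type) (s : seq I) (f : I -> K) n :
  (forall i, (n%:E <= v (f i))%E) -> (n%:E <= v (\sum_(i <- s) f i)%R)%E.
Proof.
move=> fn; apply: (big_ind (fun x => (n%:E <= v x)%E)) => //.
  by rewrite place_val0 leey.
by move=> x y; exact: place_ge_add.
Qed.

(* g^m - 1 = (g - 1)(1 + g + ... + g^(m-1)) and the second factor is congruent to
   m, a unit in characteristic 0. *)
Lemma one_units_root g n m : one_units 1 g -> m != 0 ->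
  one_units n (g ^ m) -> one_units n g.
Proof.
have nat_case p : one_units 1 g -> one_units n (g ^+ p.+1) -> one_units n g.
  move=> g1 [_ gp]; split; first by case: g1.
  move: gp; rewrite subrX1 place_valM; set s := \sum_(i < _) _.
  have vs : ~ (1%:E <= v s)%E.
    move=> s1; have : (1%:E <= v (s - \sum_(i < p.+1) (g ^+ i - 1))%R)%E.
      apply: place_ge_sub => //; apply: place_ge_sum => i.
      by have [] := division_closedXz i (one_units_division_closed 1) g1.
    rewrite sumrB opprB addrC subrK sumr_const card_ord place_val_nat//.
  have s0 : s != 0 by apply: contra_notN vs => /eqP ->; rewrite place_val0 leey.
  have [g10|g10] := eqVneq (g - 1) 0; first by rewrite g10 place_val0 leey.
  have [a ->] := place_valP v g10; have [b vb] := place_valP v s0.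
  rewrite vb -EFinD !lee_fin => /le_trans; apply; rewrite gerDl.
  by move: vs; rewrite vb lee_fin => /negP; rewrite -ltNge -[1]add0r ltzD1.
move=> g1; case: m => [[//|p] _|p _]; first exact: nat_case.
rewrite NegzE -exprnN => /(division_closedV (one_units_division_closed n)).
by rewrite invrK; exact: nat_case.
Qed.

Lemma place_valXz (w : place iota) g a (m : int) :
  w g = a%:E -> w (g ^ m) = (m * a)%:E.
Proof.
move=> wg; have wX n : w (g ^+ n) = (n%:Z * a)%:E.
  elim: n => [|n IHn]; first by rewrite expr0 place_val1 mul0r.
  by rewrite exprS place_valM wg IHn intS mulrDl mul1r.
case: m => n; first exact: wX.
by rewrite NegzE -exprnN (place_valV (wX n.+1)) mulNr.
Qed.

Hypothesis K_k : function_field iota.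

(** Induction on the places where [H] may have nonzero values. The elements with [w g = 0] form a
    subgroup with some bound [n']. If [n'] fails for [H] because of [g0], with [v (g0 - 1) = e],
    then [e + 1] is a bound for [H]. *)
Lemma one_units_discrete (s : seq {classic place iota}) (H : set K) :
    division_closed H -> H `<=` one_units 1 ->
    (forall (w : {classic place iota}) g, w \notin s -> H g ->
      (w : place iota) g = 0%:E) ->
  exists n, forall g, H g -> (n%:E <= v (g - 1)%R)%E -> g = 1.
Proof.
elim: s H => [|w s IHs] H Hc H1 Hs.
  (* With no place left, [g] has no pole and lies in [k], where [v] is trivial. *)
  exists 1 => g Hg g1; have [[a _ ag]|/(exists_pole char_k K_k)[w]] := pselect (range iota g).
    have [a1|a1] := eqVneq a 1; first by rewrite -ag a1 rmorph1.
    by move: g1; rewrite -ag -(rmorph1 iota) -rmorphB place_val_base ?subr_eq0.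
  by rewrite (Hs w g)// ltxx.
have [||w' g|n' Hn'] := IHs [set g | H g /\ w g = 0%:E].
- split; first by split; [exact: Hc.1|exact: place_val1].
  move=> g h [Hg wg] [Hh wh]; split; first exact: Hc.2.
  by rewrite place_valM wg (place_valV wh) oppr0 add0e.
- by move=> g [/H1].
- move=> w's [Hg wg]; have [->//|ww] := eqVneq (w' : {classic place iota}) w.
  by apply: Hs => //; rewrite inE negb_or ww.
have [[g0 [Hg0 g01 ng0]]|nex] :=
  pselect (exists g, [/\ H g, g != 1 & (n'%:E <= v (g - 1)%R)%E]); last first.
  exists n' => g Hg ng; apply/eqP; apply: contra_notT nex => g1; by exists g.
have [e vg0] : {e | v (g0 - 1) = e%:E} by apply: place_valP; rewrite subr_eq0.
exists (e + 1) => g Hg ng; apply/eqP; apply: contraT => g1.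
have n'e : n' <= e by rewrite -lee_fin -vg0.
have fin h : H h -> {a | w h = a%:E}.
  move=> /H1/one_units_val vh; apply: place_valP.
  by rewrite -(place_val_eqy v) vh.
have [[c wg] [d wg0]] := (fin g Hg, fin g0 Hg0).
have d0 : d != 0.
  by apply: contra_neq g01 => d0; apply: Hn' ng0; split=> //; rewrite wg0 d0.
have c0 : c != 0.
  apply: contra_neq g1 => c0; apply: (Hn' g); first by split=> //; rewrite wg c0.
  by apply: le_trans ng; rewrite lee_fin (le_trans n'e)// lerDl.
have Ug : one_units (e + 1) g by split=> //; have [] := H1 g Hg.
have Ug0 : one_units e g0 by split; [have [] := H1 g0 Hg0|rewrite vg0].
(* The exponents make the values at [w] cancel, and the product has level [e >= n'], so the bound
   [n'] applies to it. *)
have hE : g ^ d * g0 ^ (- c) = 1.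
  apply: Hn'.
    split; first by apply: division_closedM => //; exact: division_closedXz.
    by rewrite place_valM (place_valXz _ wg) (place_valXz _ wg0) -EFinD mulNr mulrC subrr.
  apply: (@le_trans _ _ e%:E); first by rewrite lee_fin.
  suff [] : one_units e (g ^ d * g0 ^ (- c)) by [].
  apply: division_closedM (one_units_division_closed e) _ _;
    apply: division_closedXz (one_units_division_closed e) _ => //.
  by case: Ug => ? ge; split=> //; apply: le_trans ge; rewrite lee_fin lerDl.
(* [g0^c = g^d] has level [e + 1], and [c != 0], so [g0] has this level too, against
   [v (g0 - 1) = e]. *)
have : one_units (e + 1) g0.
  apply: (@one_units_root _ _ c) => //; first by have := H1 g0 Hg0.
  have -> : g0 ^ c = g ^ d.
    have g00 : g0 != 0 by rewrite -(place_val_eqy v) (one_units_val Ug0).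
    by rewrite -[LHS]mul1r -hE -mulrA -expfzDr// addrC subrr expr0z mulr1.
  exact: division_closedXz (one_units_division_closed _) Ug.
by case=> _; rewrite vg0 lee_fin gerDl ler10.
Qed.
End OneUnits.

(** * Topology *)

Section Discreteness.
Variables (k K : fieldType) (iota : {rmorphism k -> K}).
Hypotheses (char_k : [pchar k] =i pred0) (K_k : function_field iota).
Variables (S : set (place iota)) (Gamma : set (mulgroup K)).
Hypotheses (S_fin : finite_set S) (Gamma_group : group_closed (mem Gamma)).
Hypothesis Gamma_S : Gamma `<=` S_units S.

Lemma mulgroup_closed1 : Gamma (mulgroup_one K).
Proof. by apply/set_mem; case: Gamma_group. Qed.

Lemma mulgroup_closed_div g h : Gamma g -> Gamma h ->
  Gamma (mulgroup_mul g (mulgroup_inv h)).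
Proof.
have [_ Gd] := Gamma_group.
by move=> Gg Gh; apply/set_mem; apply: Gd; exact: mem_set.
Qed.

(** The values of [g] and of its inverse are both nonnegative, and they are opposite. *)
Lemma S_units_val (w : place iota) g : Gamma g -> ~ S w -> w (\val g) = 0%:E.
Proof.
move=> /Gamma_S[gS [h hS gh]] wS.
have [a wg] := place_valP w (mulgroup_neq0 g).
have wh : w h = (- a)%:E.
  rewrite -(place_valV wg); congr (w _).
  by rewrite -[RHS]mulr1 -gh mulKf// mulgroup_neq0.
move: (gS w wS) (hS w wS); rewrite wg wh !lee_fin oppr_ge0 => a0 a0'.
by congr EFin; apply/eqP; rewrite eq_le a0 a0'.
Qed.

(** The isolation of [1] among the one-units of [Gamma] spreads to all pairs through quotients. *)
Lemma Gamma_discrete (v : place iota) : exists n : int, 0 <= n /\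
  forall g h, Gamma g -> Gamma h -> (n%:E <= v (\val g / \val h - 1)%R)%E -> g = h.
Proof.
have /finite_seqP[s Ss] : finite_set (S : set {classic place iota}) by [].
pose H := [set x | (exists2 g, Gamma g & \val g = x) /\ one_units v 1 x].
have [||w g ws|n Hn] := @one_units_discrete _ _ _ v char_k K_k s H.
- split; first split; first by exists (mulgroup_one K) => //; exact: mulgroup_closed1.
    exact: (one_units_division_closed v 1).1.
  move=> g h [[g' Gg' <-] g1] [[h' Gh' <-] h1]; split.
    by exists (mulgroup_mul g' (mulgroup_inv h')) => //; exact: mulgroup_closed_div.
  exact: (one_units_division_closed v 1).2.
- by move=> g [].
- move=> [[g' Gg' <-] _]; apply: S_units_val => //.
  by move=> Sw; move/negP: ws; apply; move: Sw; rewrite Ss.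
(* The bound is at least [1], so that [g / h] is a one-unit and belongs to [H]. *)
exists (Num.max 1 n); split; first by rewrite le_max ler01.
move=> g h Gg Gh gh; apply: val_inj; apply: (mulIf (invr_neq0 (mulgroup_neq0 h))).
rewrite mulfV ?mulgroup_neq0//; apply: Hn; last first.
  by apply: le_trans gh; rewrite lee_fin le_max lexx orbT.
split; last by split; apply: le_trans gh; rewrite lee_fin le_max lexx.
by exists (mulgroup_mul g (mulgroup_inv h)) => //; exact: mulgroup_closed_div.
Qed.

Lemma nbhs_mulgroup (v : place iota) (z : mulgroup (completion v)) (n : int) :
  nbhs z [set y : mulgroup (completion v) | completion_ge n (\val y - \val z)].
Proof.
have : nbhs (\val z) [set y : completion v | completion_ge n (y - \val z)].
  by apply/completion_nbhsP; exists n.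
by move/(@initial_continuous _ _ (set_val : set_type (nonzero (completion v)) -> _) z).
Qed.

(* Since z is nonzero, the elements of Gamma close to z have bounded valuation, so
   two of them which are close to each other have a quotient close to 1. *)
Lemma isolating_nbhs (v : place iota) (z : mulgroup (completion v)) :
  exists2 U : set (mulgroup (completion v)), nbhs z U &
    forall g h, Gamma g -> Gamma h ->
      U (mulgroup_embed v g) -> U (mulgroup_embed v h) -> g = h.
Proof.
have [n [n0 Hn]] := Gamma_discrete v.
have [l zl] : exists l, ~ completion_ge l (\val z).
  apply/existsNP => zl; have /eqP := mulgroup_neq0 z; apply.
  exact: completion_ge_eq0.
exists [set y | completion_ge (n + l) (\val y - \val z)]; first exact: nbhs_mulgroup.
move=> g h Gg Gh /= gz hz; apply: Hn => //.
have gh : ((n + l)%:E <= v (\val g - \val h)%R)%E.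
  apply/completion_ge_embed; rewrite rmorphB.
  by apply: completion_ge_split gz _; exact: completion_ge_dist.
have [b vh] := place_valP v (mulgroup_neq0 h).
(* Otherwise [z = (z - h) + h] would have value at least [l]. Hence
   [v (g/h - 1) >= n + l - b >= n]. *)
have bl : b < l.
  rewrite ltNge; apply/negP => lb; apply: zl.
  rewrite -[\val z](subrK (completion_embed v (\val h))).
  apply: completion_geD; last by apply/completion_ge_embed; rewrite vh lee_fin.
  by apply: completion_ge_mono (completion_ge_dist hz); rewrite lerDr.
have -> : \val g / \val h - 1 = (\val g - \val h) * (\val h)^-1.
  by rewrite mulrBl mulfV// mulgroup_neq0.
apply: (@le_trans _ _ (n + l - b)%:E).
  by rewrite lee_fin -addrA lerDl subr_ge0 ltW.
by apply: place_ge_mul => //; rewrite (place_valV vh).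
Qed.

Lemma adic_subtopology_discrete (v : place iota) (A : set (adic_subtopology Gamma v)) :
  open A.
Proof.
rewrite openE => g Ag.
have [U gU Usep] := isolating_nbhs (mulgroup_embed v (\val g)).
have gU' : nbhs g [set h : adic_subtopology Gamma v | U (mulgroup_embed v (\val h))].
  exact: (@initial_continuous _ _ (fun g : Gamma => mulgroup_embed v (\val g)) g U gU).
apply: (filterS _ gU') => h /= hU; suff -> : h = g by [].
apply: val_inj; apply: Usep => //; [exact/set_mem/valP|exact/set_mem/valP|].
exact: nbhs_singleton gU.
Qed.

(** An isolating neighbourhood of a single coordinate of [p] pins down one element [g0] of [Gamma].
    Since [p] is adherent to the image of [Gamma], every other coordinate of [p] is arbitrarily
    close to [g0]. *)
Lemma closure_diag_mulgroup (Om : set (place iota)) :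
  closure (diag_mulgroup Om @` Gamma) = diag_mulgroup Om @` Gamma.
Proof.
apply/seteqP; split; last exact: subset_closure.
move=> p clp; have [[v0 Omv0]|nOm] := pselect (exists v, Om v); last first.
  (* The empty product is a single point, the image of [1]. *)
  exists (mulgroup_one K); first exact: mulgroup_closed1.
  apply: functional_extensionality_dep => v.
  by exfalso; apply: nOm; exists (\val v); exact/set_mem/valP.
pose v : Om := SigSub (mem_set Omv0).
have nbhs_proj (w : Om) (U : set (mulgroup (completion (\val w)))) :
    nbhs (p w) U -> nbhs p [set q : prod_mulgroup Om | U (q w)].
  exact: (@proj_continuous {classic Om} (fun w : Om => mulgroup (completion (\val w)))).
have [U pU Usep] := isolating_nbhs (p v).
have [_ [[g0 Gg0 <-] Ug0]] := clp _ (nbhs_proj v U pU).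
exists g0 => //; apply: functional_extensionality_dep => w.
apply: val_inj; apply/eqP; rewrite -subr_eq0; apply/eqP/completion_ge_eq0 => n.
have [_ [[h Gh <-] [Uh hn]]] :=
  clp _ (filterI (nbhs_proj v U pU) (nbhs_proj w _ (nbhs_mulgroup (p w) n))).
by rewrite (Usep g0 h).
Qed.
End Discreteness.

Theorem theorem1p1 (k K : fieldType) (iota : {rmorphism k -> K})
    (char_k : [pchar k] =i pred0) (K_k : function_field iota)
    (S : set (place iota)) (S_fin : finite_set S)
    (Gamma : set (mulgroup K)) (Gamma_group : group_closed (mem Gamma))
    (Gamma_S : Gamma `<=` S_units S) :
  (forall (v : place iota) (A : set (adic_subtopology Gamma v)), open A) /\
  (forall (M : nat) (b : 'I_M -> mulgroup K) (Om : set (place iota)),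
     cofinite_set Om ->
     let Gamma_Om := diag_mulgroup Om @` Gamma in
     W (diag Om) b (prod_val @` closure Gamma_Om) =
       W (diag Om) b (prod_val @` Gamma_Om) /\
     W' (diag Om) b (prod_val @` closure Gamma_Om) =
       W' (diag Om) b (prod_val @` Gamma_Om)).
Proof.
split=> [v A|M b Om _ Gamma_Om].
  exact: (adic_subtopology_discrete char_k K_k S_fin Gamma_group Gamma_S).
by rewrite /Gamma_Om (closure_diag_mulgroup char_k K_k S_fin Gamma_group Gamma_S).
Qed.
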